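(* Let $W_{\boldsymbol\lambda}\in\boldsymbol B(\ell^2)$ be a non-subnormal CPD unilateral weighted shift. Then $W_{\boldsymbol\lambda}$ is a quasi-affine transform of any contractive subnormal unilateral weighted shift $W_{\boldsymbol\omega}\in\boldsymbol B(\ell^2)$ (including the unilateral shift, i.e. the one with all weights equal to $1$). Moreover, every subnormal unilateral weighted shift of type I or type II has norm $1$.
   Context: $\mathbb Z_+=\{0,1,2,\dots\}$, $\mathbb R_+=[0,\infty)$; $\boldsymbol B(\mathcal H,\mathcal K)$ denotes bounded linear operators between complex Hilbert spaces, $\boldsymbol B(\mathcal H)=\boldsymbol B(\mathcal H,\mathcal H)$; $\{e_n\}_{n=0}^\infty$ is the standard orthonormal basis of $\ell^2=\ell^2(\mathbb Z_+)$. Unilateral weighted shift: for a bounded sequence $\boldsymbol\lambda=\{\lambda_n\}_{n=0}^\infty\subseteq(0,\infty)$, $W_{\boldsymbol\lambda}\in\boldsymbol B(\ell^2)$ is the operator with $W_{\boldsymbol\lambda}e_n=\lambda_n e_{n+1}$, $n\in\mathbb Z_+$. Put $\hat\lambda_0=1$ and $\hat\lambda_n=\lambda_0^2\cdots\lambda_{n-1}^2$ for $n\geqslant1$. CPD: $T\in\boldsymbol B(\mathcal H)$ is conditionally positive definite (CPD) if for every $h\in\mathcal H$ the sequence $\gamma_n=\|T^nh\|^2$ satisfies $\sum_{i,j=0}^k\gamma_{i+j}\alpha_i\bar\alpha_j\geqslant0$ for all finite complex sequences $\alpha_0,\dots,\alpha_k$ with $\sum_{j=0}^k\alpha_j=0$.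 Every subnormal operator is CPD. Scalar representing triplet: let $Q_0=Q_1=0$ and $Q_n(x)=\sum_{j=0}^{n-2}(n-j-1)x^j$ for $n\geqslant2$. It is known that $W_{\boldsymbol\lambda}$ is CPD if and only if there are $\mathfrak b\in\mathbb R$, $\mathfrak c\in\mathbb R_+$ and a compactly supported finite positive Borel measure $\nu$ on $\mathbb R_+$ with $\nu(\{1\})=0$ such that $\hat\lambda_n=1+\mathfrak bn+\mathfrak cn^2+\int_{\mathbb R_+}Q_n\,\mathrm d\nu$ for all $n\in\mathbb Z_+$; the triplet $(\mathfrak b,\mathfrak c,\nu)$ is then unique and is called the scalar representing triplet of $W_{\boldsymbol\lambda}$. Types: a CPD unilateral weighted shift with scalar representing triplet $(\mathfrak b,\mathfrak c,\nu)$ is of type I if $\nu=0$ and $\mathfrak c=0$; of type II if $\operatorname{supp}\nu=\{0\}$ and $\mathfrak c=0$; of type III if $\operatorname{supp}\nu\nsubseteq\{0\}$ or $\mathfrak c\neq0$. An operator $X\in\boldsymbol B(\mathcal H,\mathcal K)$ is quasi-invertible if it is injective and has dense range. $A\in\boldsymbol B(\mathcal H)$ is a quasi-affine transform of $B\in\boldsymbol B(\mathcal K)$ if there is a quasi-invertible $X\in\boldsymbol B(\mathcal H,\mathcal K)$ with $XA=BX$. Contractive means norm at most $1$. *)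

(* Defs.v *)
From HB Require Import structures.
From mathcomp Require Import all_boot all_order all_algebra complex ring lra.
From mathcomp Require Import all_classical all_reals all_analysis.

Set Implicit Arguments.
Unset Strict Implicit.
Unset Printing Implicit Defensive.

Import Order.TTheory GRing.Theory Num.Theory.
Import numFieldNormedType.Exports.

Local Open Scope classical_set_scope.
Local Open Scope ring_scope.

Definition dot_norm (R : realType) (V : lmodType R[i])
  (dot : {dot V for Num.conj}) (x : V) : R := Num.sqrt (complex.Re (dot x x)).

Definition dot_complete (R : realType) (V : lmodType R[i])
  (dot : {dot V for Num.conj}) : Prop :=
  forall u : nat -> V,
    (forall e : R, 0 < e -> exists N : nat, forall m n : nat,
       (N <= m)%N -> (N <= n)%N -> dot_norm dot (u m - u n) < e) ->
    exists l : V, dot_norm dot (u n - l) @[n --> \oo] --> (0 : R).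

(* The inner product is linear in its first argument. *)
Record hilbert (R : realType) := Hilbert {
  hilbert_sort :> lmodType R[i];
  hdot : {dot hilbert_sort for Num.conj};
  hilbert_complete : dot_complete hdot }.

Definition hnorm (R : realType) (H : hilbert R) (x : H) : R :=
  dot_norm (hdot H) x.

Definition bounded_op (R : realType) (H K : hilbert R) (T : H -> K) : Prop :=
  exists M : R, forall x : H, hnorm (T x) <= M * hnorm x.

Record bop (R : realType) (H K : hilbert R) := Bop {
  bop_fun :> {linear H -> K};
  bopP : bounded_op bop_fun }.

Definition opnorm (R : realType) (H K : hilbert R) (T : bop H K) : R :=
  sup [set hnorm (T x) | x in [set x : H | hnorm x <= 1]].

Definition adjoint (R : realType) (H K : hilbert R) (T : bop H K)
  (S : bop K H) : Prop :=
  forall (x : H) (y : K), hdot K (T x) y = hdot H x (S y).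

Definition normal_op (R : realType) (H : hilbert R) (N : bop H H) : Prop :=
  exists2 S : bop H H, adjoint N S & forall x : H, N (S x) = S (N x).

(* The space H is identified with a closed subspace of K through the linear
   isometry V; the intertwining relation says that this subspace is invariant
   for N and that T is the restriction of N to it. *)
Definition subnormal (R : realType) (H : hilbert R) (T : bop H H) : Prop :=
  exists (K : hilbert R) (N : bop K K) (V : {linear H -> K}),
    [/\ normal_op N,
        forall x y : H, hdot K (V x) (V y) = hdot H x y &
        forall x : H, V (T x) = N (V x)].

(* On R[i], 0 <= z means that z is real and nonnegative. *)
Definition cpd (R : realType) (H : hilbert R) (T : bop H H) : Prop :=
  forall (h : H) (k : nat) (alpha : 'I_k.+1 -> R[i]),
    \sum_(j < k.+1) alpha j = 0 ->
    0 <= \sum_(i < k.+1) \sum_(j < k.+1)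
      ((hnorm (iter (i + j)%N T h) ^+ 2)%:C)%C * alpha i * Num.conj (alpha j).

Definition quasi_invertible (R : realType) (H K : hilbert R) (X : bop H K)
  : Prop :=
  injective X /\
  (forall (y : K) (e : R), 0 < e -> exists x : H, hnorm (y - X x) < e).

Definition quasi_affine_transform (R : realType) (H K : hilbert R)
  (A : bop H H) (B : bop K K) : Prop :=
  exists2 X : bop H K, quasi_invertible X & forall x : H, X (A x) = B (X x).

Section Ell2.
Variable R : realType.
Implicit Types x y : nat -> R[i].

Definition sqmod (z : R[i]) : R := complex.Re z ^+ 2 + complex.Im z ^+ 2.

Definition sqsummable x : Prop := cvgn (series (fun n => sqmod (x n))).

Definition ell2_pred : {pred nat -> R[i]} := fun x => `[< sqsummable x >].

Lemma ell2_predP x : reflect (sqsummable x) (x \in ell2_pred).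
Proof. exact: asboolP. Qed.

Lemma sqmod_ge0 (z : R[i]) : 0 <= sqmod z.
Proof. by rewrite addr_ge0 ?sqr_ge0. Qed.

Lemma sqmodM (z w : R[i]) : sqmod (z * w) = sqmod z * sqmod w.
Proof. by case: z w => [p q] [r s]; rewrite /sqmod /=; ring. Qed.

Lemma sqmodD (z w : R[i]) : sqmod (z + w) <= 2 * sqmod z + 2 * sqmod w.
Proof.
case: z w => [p q] [r s]; rewrite /sqmod /= -subr_ge0.
rewrite [leRHS](_ : _ = (p - r) ^+ 2 + (q - s) ^+ 2); last by ring.
by rewrite addr_ge0 ?sqr_ge0.
Qed.

Lemma ell2_submod : submod_closed ell2_pred.
Proof.
split.
  apply/ell2_predP; rewrite /sqsummable.
  rewrite (_ : series _ = cst 0); first exact: is_cvg_cst.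
  apply/funext => n; rewrite /series /= big1// => i _.
  by rewrite /sqmod/= expr0n addr0.
move=> c x y /ell2_predP hx /ell2_predP hy; apply/ell2_predP.
apply: (@series_le_cvg _ _
  ((2 * sqmod c) *: (fun n => sqmod (x n)) +
   (2 : R) *: (fun n => sqmod (y n)))).
- by move=> n; exact: sqmod_ge0.
- by move=> n; apply: addr_ge0; apply: mulr_ge0; rewrite ?mulr_ge0 ?sqmod_ge0.
- by move=> n; rewrite (le_trans (sqmodD _ _))// sqmodM mulrA.
- by apply: is_cvg_seriesD; exact: is_cvg_seriesZ.
Qed.

HB.instance Definition _ := GRing.isSubmodClosed.Build _ _ ell2_pred
  ell2_submod.

Record ell2_sort := Ell2 {
  ell2_val :> nat -> R[i];
  _ : ell2_val \in ell2_pred }.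
HB.instance Definition _ := [isSub for ell2_val].
HB.instance Definition _ := [Choice of ell2_sort by <:].
HB.instance Definition _ := [SubChoice_isSubLmodule of ell2_sort by <:].

Implicit Types u v : ell2_sort.

Lemma ell2P u : sqsummable u.
Proof. by apply/ell2_predP; case: u. Qed.

Definition ell2_mul u v (n : nat) : R[i] := u n * Num.conj (v n).

(* The sum of the series with general term u n * conj (v n). *)
Definition ell2_dot u v : R[i] :=
  Complex (limn (series (fun n => complex.Re (ell2_mul u v n))))
          (limn (series (fun n => complex.Im (ell2_mul u v n)))).

Lemma ell2_mul_le u v n :
  `|complex.Re (ell2_mul u v n)| <= sqmod (u n) + sqmod (v n) /\
  `|complex.Im (ell2_mul u v n)| <= sqmod (u n) + sqmod (v n).
Proof.
rewrite /ell2_mul; case: (u n) (v n) => [p q] [r s]; rewrite /sqmod /=.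
have sq (t : R) : 0 <= t ^+ 2 by exact: sqr_ge0.
rewrite !ler_norml; split; apply/andP; split.
- by have := sq (p + r); have := sq (q + s); nra.
- by have := sq (p - r); have := sq (q - s); nra.
- by have := sq (p - s); have := sq (q + r); nra.
- by have := sq (p + s); have := sq (q - r); nra.
Qed.

Lemma is_cvg_ell2_mul u v :
  cvgn (series (fun n => complex.Re (ell2_mul u v n))) /\
  cvgn (series (fun n => complex.Im (ell2_mul u v n))).
Proof.
have h := is_cvg_seriesD (@ell2P u) (@ell2P v).
split; apply: normed_cvg; apply: (series_le_cvg _ _ _ h) => n //=.
- by rewrite addr_ge0 ?sqmod_ge0.
- by have [] := ell2_mul_le u v n.
- by rewrite addr_ge0 ?sqmod_ge0.
- by have [] := ell2_mul_le u v n.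
Qed.

Lemma is_cvg_series_lin (c d : R) (a b : R ^nat) :
  cvgn (series a) -> cvgn (series b) ->
  cvgn (series (fun n => c * a n + d * b n)).
Proof.
move=> /(@is_cvg_seriesZ _ _ c) ha /(@is_cvg_seriesZ _ _ d) hb.
exact: (is_cvg_seriesD ha hb).
Qed.

Lemma limn_series_lin (c d : R) (a b : R ^nat) :
  cvgn (series a) -> cvgn (series b) ->
  limn (series (fun n => c * a n + d * b n)) =
  c * limn (series a) + d * limn (series b).
Proof.
move=> ha hb.
rewrite -[c * limn _]/(c *: limn _) -[d * limn _]/(d *: limn _).
rewrite -!lim_seriesZ//; by rewrite -lim_seriesD//; exact: is_cvg_seriesZ.
Qed.

Lemma ell2_dotP (c : R[i]) u v w :
  ell2_dot (c *: u + v) w = c * ell2_dot u w + ell2_dot v w.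
Proof.
have [r1 i1] := is_cvg_ell2_mul u w; have [r2 i2] := is_cvg_ell2_mul v w.
have l1 : limn (series (fun n => complex.Re (ell2_mul (c *: u + v) w n))) =
    complex.Re (c * ell2_dot u w + ell2_dot v w).
  rewrite [X in series X](_ : _ = fun n =>
      1 * (complex.Re c * complex.Re (ell2_mul u w n) +
      - complex.Im c * complex.Im (ell2_mul u w n)) + 1 *
      complex.Re (ell2_mul v w n)).
    rewrite (@limn_series_lin _ _ _ _ (@is_cvg_series_lin _ _ _ _ r1 i1) r2).
    by rewrite limn_series_lin// !mul1r mulNr; case: (c).
  apply/funext => n; rewrite /ell2_mul -[ell2_val _ n]/(c * u n + v n).
  by case: (c) (ell2_val u n) (ell2_val v n) (ell2_val w n)
    => [? ?] [? ?] [? ?] [? ?] /=; ring.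
have l2 : limn (series (fun n => complex.Im (ell2_mul (c *: u + v) w n))) =
    complex.Im (c * ell2_dot u w + ell2_dot v w).
  rewrite [X in series X](_ : _ = fun n =>
      1 * (complex.Re c * complex.Im (ell2_mul u w n) +
      complex.Im c * complex.Re (ell2_mul u w n)) + 1 *
      complex.Im (ell2_mul v w n)).
    rewrite (@limn_series_lin _ _ _ _ (@is_cvg_series_lin _ _ _ _ i1 r1) i2).
    by rewrite limn_series_lin// !mul1r; case: (c).
  apply/funext => n; rewrite /ell2_mul -[ell2_val _ n]/(c * u n + v n).
  by case: (c) (ell2_val u n) (ell2_val v n) (ell2_val w n)
    => [? ?] [? ?] [? ?] [? ?] /=; ring.
by rewrite {1}/ell2_dot l1 l2; case: (_ + _).
Qed.

Lemma ell2_dotC u v : ell2_dot u v = Num.conj (ell2_dot v u).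
Proof.
have [r1 i1] := is_cvg_ell2_mul v u.
rewrite /ell2_dot -[RHS]/(Complex _ _); congr Complex.
  congr (limn (series _)); apply/funext => n; rewrite /ell2_mul.
  by case: (u n) (v n) => [? ?] [? ?] /=; ring.
rewrite -lim_seriesN//.
congr (limn (series _)); apply/funext => n; rewrite /ell2_mul /=.
by rewrite -[RHS]/(- _); case: (u n) (v n) => [? ?] [? ?] /=; ring.
Qed.

Lemma ell2_dot_is_bilinear :
  bilinear_for (GRing.Scale.Law.clone _ _ *%R _)
    (GRing.Scale.Law.clone _ _ (Num.conj \; *%R) _) ell2_dot.
Proof.
split=> [w c u v|w c u v]; first exact: ell2_dotP.
by rewrite ell2_dotC ell2_dotP rmorphD rmorphM/= -!ell2_dotC.
Qed.

HB.instance Definition _ :=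
  bilinear_isBilinear.Build _ _ _ _ _ _ ell2_dot ell2_dot_is_bilinear.

Lemma ell2_dot_is_hermitian u v :
  ell2_dot u v = (-1) ^+ false * Num.conj (ell2_dot v u).
Proof. by rewrite expr0 mul1r ell2_dotC. Qed.

HB.instance Definition _ := isHermitianSesquilinear.Build _ _ _ _ ell2_dot
  ell2_dot_is_hermitian.

Lemma ell2_dotxx u :
  ell2_dot u u = ((limn (series (fun n => sqmod (u n))))%:C)%C.
Proof.
rewrite /ell2_dot; congr Complex.
  congr (limn (series _)); apply/funext => n; rewrite /ell2_mul /sqmod.
  by case: (u n) => ? ? /=; ring.
rewrite [X in series X](_ : _ = fun=> 0).
  rewrite (_ : series _ = cst 0) ?lim_cst//.
  by apply/funext => n; rewrite /series /= big1.
by apply/funext => n; rewrite /ell2_mul; case: (u n) => ? ? /=; ring.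
Qed.

Lemma series_sqmod_nd (x : nat -> R[i]) :
  nondecreasing_seq (series (fun n => sqmod (x n))).
Proof. by apply: nondecreasing_series => n _ _; exact: sqmod_ge0. Qed.

Lemma sum_sqmod_le u n :
  \sum_(0 <= k < n) sqmod (u k) <= complex.Re (ell2_dot u u).
Proof.
rewrite ell2_dotxx; apply: (nondecreasing_cvgn_le (@series_sqmod_nd u)).
exact: ell2P.
Qed.

Lemma sqmod_le u n : sqmod (u n) <= complex.Re (ell2_dot u u).
Proof.
apply: le_trans (sum_sqmod_le u n.+1).
by rewrite big_nat_recr//= lerDr sumr_ge0// => i _; exact: sqmod_ge0.
Qed.

Lemma sqmod_eq0 (z : R[i]) : sqmod z <= 0 -> z = 0.
Proof.
case: z => p q; rewrite /sqmod /= => h.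
have /eqP : p ^+ 2 + q ^+ 2 = 0.
  by apply/eqP; rewrite eq_le h addr_ge0 ?sqr_ge0.
by rewrite paddr_eq0 ?sqr_ge0// !sqrf_eq0 => /andP[/eqP-> /eqP->].
Qed.

Lemma ell2_dot_gt0 u : u != 0 -> 0 < ell2_dot u u.
Proof.
move=> u0; rewrite ell2_dotxx ltcR lt_neqAle eq_sym; apply/andP; split.
  apply: contra u0 => /eqP l0; apply/eqP/val_inj/funext => n /=.
  by apply: sqmod_eq0; have := sqmod_le u n; rewrite ell2_dotxx /= l0.
by have := sum_sqmod_le u 0; rewrite big_geq// ell2_dotxx.
Qed.

HB.instance Definition _ := isDotProduct.Build _ _ ell2_dot ell2_dot_gt0.

Definition ell2_form : {dot ell2_sort for Num.conj} := ell2_dot.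

Definition ell2_norm u : R := dot_norm ell2_form u.

Lemma ell2_normE u :
  ell2_norm u = Num.sqrt (limn (series (fun n => sqmod (u n)))).
Proof. by rewrite /ell2_norm /dot_norm [X in complex.Re X](ell2_dotxx u). Qed.

Lemma ell2_norm_lt u (e : R) : 0 < e -> ell2_norm u < e ->
  forall n, \sum_(0 <= k < n) sqmod (u k) <= e ^+ 2.
Proof.
move=> e0 ue n; apply: (le_trans (sum_sqmod_le u n)).
have d0 : 0 <= complex.Re (ell2_dot u u).
  by have := sum_sqmod_le u 0; rewrite big_geq.
by rewrite -(sqr_sqrtr d0) ler_sqr ?nnegrE ?sqrtr_ge0 ?ltW.
Qed.

Lemma series_sqmod_bounded (x : nat -> R[i]) (C : R) :
  (forall n, \sum_(0 <= k < n) sqmod (x k) <= C) ->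
  sqsummable x /\ limn (series (fun n => sqmod (x n))) <= C.
Proof.
move=> hC.
have cx : sqsummable x.
  apply: nondecreasing_is_cvgn; first exact: series_sqmod_nd.
  by exists C => _ [n _ <-]; exact: hC.
by split=> //; apply: limr_le => //; apply: nearW => n; exact: hC.
Qed.

Lemma cauchy_real (a : R ^nat) :
  (forall e : R, 0 < e -> exists N : nat, forall m n : nat,
     (N <= m)%N -> (N <= n)%N -> `|a m - a n| < e) -> cvgn a.
Proof.
move=> h; apply/cauchy_cvgP/cauchy_exP => e e0.
have [N hN] := h e e0; exists (a N), N => //= n Nn.
by apply: hN.
Qed.

Lemma ell2_complete : dot_complete ell2_form.
Proof.
move=> u cu.
have coord (m n k : nat) (e : R) : 0 < e -> ell2_norm (u m - u n) < e ->
    `|complex.Re (u m k) - complex.Re (u n k)| <= e /\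
    `|complex.Im (u m k) - complex.Im (u n k)| <= e.
  move=> e0 /(ell2_norm_lt e0)/(_ k.+1).
  rewrite big_nat_recr//= => h.
  have {h} : sqmod (u m k - u n k) <= e ^+ 2.
    apply: le_trans h; rewrite lerDr.
    by apply: sumr_ge0 => i _; exact: sqmod_ge0.
  case: (u m k) (u n k) => [p q] [r s]; rewrite /sqmod /= => h.
  split; rewrite -(@ler_pXn2r _ 2)// ?nnegrE ?(ltW e0)// real_normK ?num_real//.
    by apply: le_trans h; rewrite lerDl sqr_ge0.
  by apply: le_trans h; rewrite lerDr sqr_ge0.
have half (e : R) : 0 < e -> 0 < e / 2 /\ e / 2 < e.
  by move=> e0; split; [rewrite divr_gt0|rewrite ltr_pdivrMr// ltr_pMr// ltr1n].
have cR k : cvgn (fun n => complex.Re (u n k)).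
  apply: cauchy_real => e /half[e0 ee].
  have [N hN] := cu _ e0; exists N => m n Nm Nn.
  by apply: le_lt_trans ee; have [] := coord m n k _ e0 (hN m n Nm Nn).
have cI k : cvgn (fun n => complex.Im (u n k)).
  apply: cauchy_real => e /half[e0 ee].
  have [N hN] := cu _ e0; exists N => m n Nm Nn.
  by apply: le_lt_trans ee; have [] := coord m n k _ e0 (hN m n Nm Nn).
pose l k : R[i] := Complex (limn (fun n => complex.Re (u n k)))
                           (limn (fun n => complex.Im (u n k))).
have bnd (e : R) : 0 < e -> exists N : nat, forall m, (N <= m)%N ->
    forall n, \sum_(0 <= k < n) sqmod (u m k - l k) <= e ^+ 2.
  move=> e0; have [N hN] := cu _ e0; exists N => m Nm n.
  have : (fun j => \sum_(0 <= k < n) sqmod (u m k - u j k)) @ \oo -->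
      \sum_(0 <= k < n) sqmod (u m k - l k).
    apply: cvg_big => [|k _]; first exact: add_continuous.
    rewrite /sqmod.
    rewrite (_ : (fun _ => _) = fun j =>
      (complex.Re (u m k) - complex.Re (u j k)) ^+ 2 +
      (complex.Im (u m k) - complex.Im (u j k)) ^+ 2); last first.
      by apply/funext => j; case: (u m k) (u j k) => [? ?] [? ?].
    rewrite [X in _ --> X](_ : _ =
      (complex.Re (u m k) - limn (fun n => complex.Re (u n k))) ^+ 2 +
      (complex.Im (u m k) - limn (fun n => complex.Im (u n k))) ^+ 2);
      last first.
      by rewrite /l; case: (u m k) => [? ?].
    apply: cvgD; rewrite expr2; apply: cvgM; apply: cvgB;
      by [exact: cvg_cst|exact: cR|exact: cI].
  move=> /cvgr_to_le; apply; exists N => //= j Nj.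
  exact: (ell2_norm_lt e0 (hN m j Nm Nj)).
have [N0 hN0] := bnd 1 ltr01.
have [s0 _] := series_sqmod_bounded (hN0 N0 (leqnn _)).
have lE : l \in ell2_pred.
  rewrite (_ : l = \val (u N0) - (fun k => u N0 k - l k)).
    by apply: rpredB; [exact: valP|exact/ell2_predP].
  by apply/funext => k; rewrite -[RHS]/(u N0 k - (u N0 k - l k)) subKr.
exists (Ell2 lE); apply/cvgrPdist_lt => e e0.
have [e20 e2] := half _ e0.
have [N hN] := bnd _ e20; exists N => //= m Nm.
have [_ hl] := series_sqmod_bounded (hN m Nm).
rewrite sub0r normrN ger0_norm ?sqrtr_ge0// (le_lt_trans _ e2)//.
rewrite -[dot_norm _ _]/(ell2_norm _) ell2_normE.
rewrite -(ger0_norm (ltW e20)) -sqrtr_sqr.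
exact: ler_wsqrtr.
Qed.

Definition ell2 : hilbert R := Hilbert ell2_complete.

Lemma ell2_hnormE (u : ell2) :
  hnorm u = Num.sqrt (limn (series (fun n => sqmod (u n)))).
Proof. exact: ell2_normE. Qed.

Lemma basis_subproof (n : nat) : (fun k => (k == n)%:R) \in ell2_pred.
Proof.
apply/ell2_predP; suff /series_sqmod_bounded[] : forall m,
  \sum_(0 <= k < m) sqmod ((k == n)%:R : R[i]) <= 1 by [].
move=> m.
rewrite (_ : \sum_(0 <= k < m) _ = (n < m)%:R :> R); first by case: (n < m)%N.
elim: m => [|m IH]; first by rewrite big_geq.
rewrite big_nat_recr//= IH ltnS /sqmod.
by case: ltngtP => _ /=; rewrite ?expr1n ?expr0n/= ?addr0 ?add0r.
Qed.

Definition basis (n : nat) : ell2 := Ell2 (basis_subproof n).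

Record weights := Weights {
  weight :> nat -> R;
  weight_gt0 : forall n, 0 < weight n;
  weight_bounded : exists M : R, forall n, weight n <= M }.

Section Shift.
Variable lam : weights.

Definition shift_seq (x : nat -> R[i]) (n : nat) : R[i] :=
  if n is m.+1 then ((lam m)%:C)%C * x m else 0.

Lemma sum_shift_seq_le (M : R) (x : nat -> R[i]) n :
  (forall n, lam n <= M) ->
  \sum_(0 <= k < n) sqmod (shift_seq x k) <=
  M ^+ 2 * \sum_(0 <= k < n) sqmod (x k).
Proof.
move=> hM; case: n => [|n]; first by rewrite !big_geq// mulr0.
rewrite big_nat_recl// [X in _ * X]big_nat_recr//=.
rewrite [X in X + _](_ : _ = 0) ?add0r; last by rewrite /sqmod /= expr0n addr0.
rewrite mulrDr mulr_sumr ler_wpDr//.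
  by apply: mulr_ge0; rewrite ?sqr_ge0 ?sqmod_ge0.
apply: ler_sum => k _; rewrite sqmodM ler_wpM2r ?sqmod_ge0//.
have l0 := ltW (weight_gt0 lam k).
by rewrite /sqmod /= expr0n addr0 ler_sqr ?nnegrE ?hM// (le_trans l0).
Qed.

Lemma shift_subproof (u : ell2) : shift_seq u \in ell2_pred.
Proof.
apply/ell2_predP; have [M hM] := weight_bounded lam.
suff /series_sqmod_bounded[] : forall n,
  \sum_(0 <= k < n) sqmod (shift_seq u k) <=
  M ^+ 2 * complex.Re (ell2_dot u u) by [].
move=> n; apply: le_trans (sum_shift_seq_le u n hM) _.
by rewrite ler_wpM2l ?sqr_ge0// sum_sqmod_le.
Qed.

Definition shift_fun (u : ell2) : ell2 := Ell2 (shift_subproof u).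

Lemma shift_fun_is_linear : linear shift_fun.
Proof.
move=> c u v; apply/val_inj/funext => -[|n].
  by rewrite -[RHS]/(c * 0 + 0) mulr0 addr0.
rewrite -[RHS]/(c * (((lam n)%:C)%C * u n) + ((lam n)%:C)%C * v n).
by rewrite -[LHS]/(((lam n)%:C)%C * (c * u n + v n)) mulrDr mulrCA.
Qed.

HB.instance Definition _ :=
  GRing.isLinear.Build _ _ _ _ shift_fun shift_fun_is_linear.

Lemma shift_fun_bounded : bounded_op (H := ell2) (K := ell2) shift_fun.
Proof.
have [M hM] := weight_bounded lam; exists M => u; rewrite !ell2_hnormE.
have M0 : 0 <= M := le_trans (ltW (weight_gt0 lam 0)) (hM 0).
rewrite -{1}(ger0_norm M0) -sqrtr_sqr -sqrtrM ?sqr_ge0// ler_wsqrtr//.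
suff /series_sqmod_bounded[] : forall n,
  \sum_(0 <= k < n) sqmod (shift_seq u k) <=
  M ^+ 2 * limn (series (fun n => sqmod (u n))) by [].
move=> n; apply: le_trans (sum_shift_seq_le u n hM) _.
rewrite ler_wpM2l ?sqr_ge0//; apply: le_trans (sum_sqmod_le u n) _.
by rewrite ell2_dotxx.
Qed.

Definition wshift : bop ell2 ell2 := Bop shift_fun_bounded.

Lemma wshift_basis (n : nat) :
  wshift (basis n) = ((lam n)%:C)%C *: basis n.+1.
Proof.
apply/val_inj/funext => -[|k] /=.
  by rewrite -[RHS]/(((lam n)%:C)%C * (0 == n.+1)%:R) mulr0.
rewrite -[RHS]/(((lam n)%:C)%C * (k.+1 == n.+1)%:R) eqSS.
by have [->|_] := eqVneq k n; rewrite ?mulr0.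
Qed.

End Shift.

Lemma one_bounded : exists M : R, forall n : nat, (fun=> 1) n <= M.
Proof. by exists 1. Qed.

Definition one_weights : weights := Weights (fun=> ltr01) one_bounded.

Definition hatw (lam : nat -> R) (n : nat) : R := \prod_(i < n) lam i ^+ 2.

(* For n = 0 and n = 1 the sum is empty. *)
Definition Qpol (n : nat) (x : R) : R :=
  \sum_(j < n.-1) (n - j - 1)%:R * x ^+ j.

Definition supp (nu : {finite_measure set (measurableTypeR R) -> \bar R})
  : set R := [set x | forall U : set R, open U -> U x -> (0 < nu U)%E].

(* A measure on R_+ is encoded as a measure on R that vanishes on the
   negative half-line. *)
Definition scalar_triplet (lam : weights) (b c : R)
    (nu : {finite_measure set (measurableTypeR R) -> \bar R}) : Prop :=
  [/\ 0 <= c, nu `]-oo, 0[%classic = 0%E, compact (supp nu),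
      nu [set 1] = 0%E &
      forall n : nat, hatw lam n =
        1 + b * n%:R + c * n%:R ^+ 2 +
        \int[nu]_(x in `[0, +oo[%classic) Qpol n x].

(* The triplet of a CPD weighted shift exists and is unique, so quantifying
   over it existentially amounts to speaking of the triplet. *)
Definition type_I (lam : weights) : Prop :=
  cpd (wshift lam) /\
  exists b c (nu : {finite_measure set (measurableTypeR R) -> \bar R}),
    [/\ scalar_triplet lam b c nu,
        forall A, measurable A -> nu A = 0%E & c = 0].

Definition type_II (lam : weights) : Prop :=
  cpd (wshift lam) /\
  exists b c (nu : {finite_measure set (measurableTypeR R) -> \bar R}),
    [/\ scalar_triplet lam b c nu, supp nu = [set 0] & c = 0].

End Ell2.

(* Main.v *)
Require Import Defs.
From HB Require Import structures.
From mathcomp Require Import all_boot all_order all_algebra complex ring lra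
  zify.
From mathcomp Require Import all_classical all_reals all_analysis
  measurable_realfun.
Set Implicit Arguments.
Unset Strict Implicit.
Unset Printing Implicit Defensive.
Import Order.TTheory GRing.Theory Num.Theory.
Local Open Scope ring_scope.

(** Write gamma_n for the product of the squares of the first n weights of a
weighted shift W; then gamma_n = ||W^n e_0||^2, and everything happens on this
sequence.

Quasi-affinity. A diagonal operator X = diag(x_n) with x_n^2 = gamma_n(omega) /
gamma_n(lambda) intertwines the two shifts, and it is injective with dense range
as soon as it is bounded. The numerator is at most 1 when W_omega is a
contraction, so all that is needed is a positive lower bound for gamma_n(lambda)
([hatw_lower_bound]).

The lower bound. Let L be the linear functional on real polynomials with L(X^n)
= gamma_n. Conditional positive definiteness, applied to the vectors W^m e_0,
says L(X^m (X-1)^2 q^2) >= 0 for all m and q, that is: for each fixed q the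
sequence m |-> L(X^m q^2) is convex. Suppose that gamma has no positive lower
bound. With q = 1, gamma is convex and positive, so it can only tend to 0; then
m |-> L(X^m q^2) tends to 0 for every q, and a convex sequence that tends to 0
is nonnegative and nonincreasing ([convex_cvg0]). Thus gamma is a Stieltjes
moment sequence carried by [0,1], and this makes W subnormal
([subnormal_of_stieltjes]), contrary to the hypothesis.

The normal extension. No representing measure is constructed. The symmetrized
sequence gamma_0, 0, gamma_1, 0, gamma_2, ... has orthogonal polynomials whose
three-term recurrence is a Jacobi matrix J with zero diagonal and off-diagonal
entries in [0,1], and ||J^n e_0||^2 = gamma_n ([jacobi_of_stieltjes]). If U is
the bilateral shift, N = J (x) U is normal because J is selfadjoint and U is
unitary, and e_n |-> J^n e_0 (x) u_n / sqrt(gamma_n) is an isometry that carries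
W to a restriction of N. The factor U serves to make the images of the e_n
orthogonal. The space l^2(N) (x) l^2(Z) is realized inside l^2 by numbering the
pairs (k, j). The unilateral shift, for which L(p) = p(1), is an instance.

Norms in types I and II. There gamma_n is an affine function of n for n >= 1,
since Q_n(0) = n - 1. A subnormal operator satisfies ||Tx||^2 <= ||T^2 x||
||x||, so the weights are nondecreasing and gamma is logarithmically convex; an
affine sequence with this property is constant. Hence all weights but the first
are 1 and the first is at most 1. *)

(** * Moment functionals on real polynomials *)

(** The common source of the Cauchy-Schwarz inequalities for moment functionals
and for inner products; a vanishes when the functional is degenerate. *)
Lemma quadratic_discriminant (R : realType) (a b c : R) :
  (forall t, 0 <= a * t ^+ 2 + 2 * b * t + c) -> b ^+ 2 <= a * c.
Proof.
move=> h; have c0 : 0 <= c by have := h 0; lra.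
have [a0|a0] := eqVneq a 0.
  have [->|b0] := eqVneq b 0; first by rewrite a0 expr0n mul0r.
  have := h (- (c + 1) / (2 * b));
    rewrite a0 mul0r add0r mulrC divfK ?mulf_neq0//.
  by lra.
have {a0} ap : 0 < a.
  rewrite lt_neqAle eq_sym a0 /= leNgt; apply/negP => an.
  pose u := 1 + (c + 1) / - a.
  have u1 : 1 <= u by rewrite lerDl divr_ge0 ?addr_ge0// oppr_ge0 ltW.
  have au : a * u = a - (c + 1) by rewrite /u; field; rewrite lt_eqF.
  have := h u; have := h (- u).
  have : a * u ^+ 2 <= a * u.
    by rewrite ler_wnM2l ?(ltW an)// expr2 ler_peMr// (le_trans ler01).
  by rewrite sqrrN au; lra.
have := h (- b / a); rewrite -(ler_pM2l ap) mulr0.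
rewrite [leRHS](_ : _ = a * c - b ^+ 2) ?subr_ge0//.
by field; rewrite gt_eqF.
Qed.

Section MomentFunctional.
Variable R : realType.
Implicit Types (g : nat -> R) (p q : {poly R}).

(** The Riesz functional of g: the linear functional that sends X^n to g n. *)
Definition riesz g p : R := \sum_(i < size p) p`_i * g i.

Lemma riesz_widen g p n : (size p <= n)%N ->
  riesz g p = \sum_(i < n) p`_i * g i.
Proof.
move=> pn; rewrite /riesz (big_ord_widen n (fun i => p`_i * g i) pn) big_mkcond.
apply: eq_bigr => i _; case: ifP => // /negbT;
  rewrite -leqNgt => /(nth_default 0) ->.
by rewrite mul0r.
Qed.

Lemma riesz_is_scalar g : scalar (riesz g).
Proof.
move=> c p q; pose n := maxn (size (c *: p + q)) (maxn (size p) (size q)).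
rewrite !(@riesz_widen g _ n) ?leq_max ?leqnn ?orbT//.
rewrite mulr_sumr -big_split; apply: eq_bigr => i _ /=.
by rewrite coefD coefZ mulrDl -mulrA.
Qed.
HB.instance Definition _ g :=
  GRing.isLinear.Build R {poly R} R _ (riesz g) (riesz_is_scalar g).

Lemma rieszZ g c p : riesz g (c *: p) = c * riesz g p.
Proof. exact: linearZ. Qed.

Lemma rieszD g p q : riesz g (p + q) = riesz g p + riesz g q.
Proof. exact: linearD. Qed.

Lemma rieszB g p q : riesz g (p - q) = riesz g p - riesz g q.
Proof. exact: linearB. Qed.

Lemma rieszXn g n : riesz g 'X^n = g n.
Proof.
rewrite /riesz size_polyXn big_ord_recr/= coefXn eqxx mul1r big1 ?add0r// => i
  _.
by rewrite coefXn ltn_eqF ?mul0r.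
Qed.

(** A linear functional is determined by its moments; identities between Riesz
functionals are proved by comparing both sides on monomials. *)
Lemma riesz_ext g (f : {poly R} -> R) : scalar f ->
  (forall n, f 'X^n = g n) -> f =1 riesz g.
Proof.
move=> fl fg p; pose F : {scalar {poly R}} :=
  HB.pack f (GRing.isLinear.Build R {poly R} R _ f fl).
rewrite -[f]/(F : _ -> _) -[p in LHS]coefK poly_def linear_sum;
  apply: eq_bigr => i _.
by rewrite linearZ /= fg.
Qed.

Lemma riesz_mulXn g m p : riesz g ('X^m * p) = riesz (fun n => g (m + n)%N) p.
Proof.
apply: (@riesz_ext _ (fun p => riesz g ('X^m * p))) p => [c u v|n].
  by rewrite mulrDr -scalerAr rieszD rieszZ.
by rewrite -exprD rieszXn.
Qed.

(** The sequence g 0, 0, g 1, 0, ... is that of a measure symmetric about 0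
whose image under squaring has moments g, so only even powers contribute. *)
Lemma riesz_even g p :
  riesz (fun n => if odd n then 0 else g n./2) p = riesz g (even_poly p).
Proof.
apply/esym;
  apply: (@riesz_ext _ (fun p => riesz g (even_poly p))) p => [c u v|n].
  by rewrite linearP rieszD rieszZ.
case: ifPn => on.
  rewrite (_ : even_poly _ = 0) ?linear0//; apply/polyP => i.
  rewrite coef_even_poly coefXn coef0; case: eqP => // e.
  by move: on; rewrite -e odd_double.
rewrite (_ : even_poly _ = 'X^(n./2)) ?rieszXn//; apply/polyP => i.
rewrite coef_even_poly !coefXn -{1}(even_halfK on).
by rewrite -!muln2 eqn_pmul2r.
Qed.

(** Positivity for the symmetrized sequence thus splits into positivity of
L(p^2) and of L(X p^2), the two Stieltjes conditions. *)
Lemma even_poly_sqr p :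
  even_poly (p ^+ 2) = even_poly p ^+ 2 + 'X * odd_poly p ^+ 2.
Proof.
set e := even_poly p; set o := odd_poly p.
have H (A B : {poly R}) : even_poly (A \Po 'X^2 + (B \Po 'X^2) * 'X) = A.
  have K (C : {poly R}) i : (C \Po 'X^2)`_i = if odd i then 0 else C`_i./2.
    rewrite coef_comp_poly_Xn// dvdn2; case: (odd i) => //=.
    by rewrite divn2.
  apply/polyP => i; rewrite coef_even_poly coefD coefMX !K odd_double doubleK.
  case: i => [|i]//=; first by rewrite addr0.
  by rewrite odd_double addr0.
rewrite -[p in LHS]poly_even_odd -/e -/o.
rewrite -[RHS](H _ (2 *: (e * o))); congr even_poly.
rewrite comp_polyD !comp_polyM comp_polyX comp_polyZ comp_polyM scaler_nat;
  ring.
Qed.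
End MomentFunctional.

(** * Orthogonal polynomials of a symmetric moment sequence *)

Section OrthogonalPolynomials.
Variables (R : realType) (g : nat -> R).
Local Notation M := (riesz g).
Hypothesis g0 : g 0%N = 1.
Hypothesis godd : forall n, odd n -> g n = 0.
Hypothesis Mpos : forall q : {poly R}, 0 <= M (q ^+ 2).
Hypothesis Mcontr : forall q : {poly R}, M ('X^2 * q ^+ 2) <= M (q ^+ 2).

Lemma riesz_cauchy_schwarz (p q : {poly R}) :
  M (p * q) ^+ 2 <= M (p ^+ 2) * M (q ^+ 2).
Proof.
apply: quadratic_discriminant => t.
rewrite (_ : _ + _ = M ((t *: p + q) ^+ 2)) ?Mpos//.
rewrite sqrrD exprZn -scalerAl !rieszD !rieszZ; ring.
Qed.

(** The monic orthogonal polynomials P_n, P_(n-1), with P_(-1) = 0. Symmetry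
kills the diagonal term of the recurrence. If P_(n-1) has norm 0, the quotient
is 0 by the convention on division; this is the right value since P_n then has
norm 0 as well. *)
Fixpoint opair (n : nat) : {poly R} * {poly R} :=
  if n is m.+1 then
    let: (p, q) := opair m in
    ('X * p - (M (p ^+ 2) / M (q ^+ 2)) *: q, p)
  else (1, 0).

Definition opoly n := (opair n).1.
Definition onorm n := M (opoly n ^+ 2).

Lemma opoly0 : opoly 0 = 1. Proof. by []. Qed.

Lemma opoly1 : opoly 1 = 'X.
Proof. by rewrite /opoly /= scaler0 subr0 mulr1. Qed.

Lemma opolyS n :
  opoly n.+2 = 'X * opoly n.+1 - (onorm n.+1 / onorm n) *: opoly n.
Proof. by rewrite /onorm /opoly /=; case: (opair n). Qed.

Lemma size_opoly_subXn n : (size (opoly n - 'X^n)%R <= n)%N.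
Proof.
suff [] : (size (opoly n - 'X^n)%R <= n)%N /\
    (size (opoly n.+1 - 'X^(n.+1))%R <= n.+1)%N by [].
elim: n => [|n [IH1 IH2]].
  by rewrite opoly0 opoly1 expr0 expr1 !subrr size_poly0.
split=> //; rewrite opolyS (exprS _ n.+1) addrAC -mulrBr.
have sz : (size (opoly n) <= n.+1)%N.
  rewrite -[opoly n](subrK 'X^n); apply: leq_trans (size_polyD _ _) _.
  by rewrite geq_max size_polyXn leqnn leqW.
apply: leq_trans (size_polyD _ _) _; rewrite size_polyN geq_max.
apply/andP; split.
  apply: leq_trans (size_polyMleq _ _) _.
  by rewrite size_polyX.
by apply: leq_trans (size_scale_leq _ _) _; rewrite leqW.
Qed.

Lemma opoly_parity n j : odd (n + j) -> M (opoly n * 'X^j) = 0.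
Proof.
suff [] : (forall j, odd (n + j) -> M (opoly n * 'X^j) = 0) /\
   (forall j, odd (n.+1 + j) -> M (opoly n.+1 * 'X^j) = 0) by move=> /(_ j).
elim: n {j} => [|n [IH1 IH2]].
  split=> j oj; first by rewrite opoly0 mul1r rieszXn godd.
  by rewrite opoly1 -exprS rieszXn godd.
split=> // j oj; rewrite opolyS mulrBl -scalerAl rieszB rieszZ mulrAC -exprS.
by rewrite mulrC IH2 ?addnS// IH1 ?mulr0 ?subr0//; move: oj => /=;
  rewrite negbK.
Qed.

Lemma riesz_mul_eq0 n (p q : {poly R}) :
  (forall j, (j < n)%N -> M (p * 'X^j) = 0) ->
  (size q <= n)%N -> M (p * q) = 0.
Proof.
move=> pq qn; rewrite -[q]coefK poly_def mulr_sumr linear_sum big1// => i _.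
by rewrite -scalerAr linearZ /= pq ?mulr0// (leq_trans _ qn).
Qed.

Lemma onorm_ge0 n : 0 <= onorm n.
Proof. exact: Mpos. Qed.

(** P_(n+1) - X P_n has degree below n + 1, so ||P_(n+1)||^2 is the inner
product of P_(n+1) and X P_n; conclude by Cauchy-Schwarz and the contractivity
of multiplication by X. Stated with its orthogonality hypothesis because it is
used inside the induction that establishes orthogonality. *)
Lemma onorm_leS n :
  (forall q : {poly R}, (size q <= n.+1)%N -> M (opoly n.+1 * q) = 0) ->
  onorm n.+1 <= onorm n.
Proof.
move=> on; have [h0|h0] := eqVneq (onorm n.+1) 0; first by rewrite h0 onorm_ge0.
have hp : 0 < onorm n.+1 by rewrite lt_neqAle eq_sym h0 onorm_ge0.
have hE : onorm n.+1 = M (opoly n.+1 * ('X * opoly n)).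
  apply/eqP; rewrite -subr_eq0 /onorm expr2 -rieszB -mulrBr; apply/eqP/on.
  case: (n) => [|m]; first by rewrite opoly1 opoly0 mulr1 subrr size_poly0.
  rewrite opolyS addrAC subrr add0r size_polyN.
  apply: leq_trans (size_scale_leq _ _) _; rewrite -[opoly m](subrK 'X^m).
  apply: leq_trans (size_polyD _ _) _; rewrite geq_max size_polyXn leqnSn andbT.
  by rewrite (leq_trans (size_opoly_subXn m))// (leq_trans (leqnSn m)).
rewrite -(ler_pM2l hp) -expr2 {1}hE.
apply: le_trans (riesz_cauchy_schwarz _ _) _.
by rewrite ler_wpM2l ?onorm_ge0// exprMn Mcontr.
Qed.

Lemma onormE n : (forall j, (j < n)%N -> M (opoly n * 'X^j) = 0) ->
  M (opoly n * 'X^n) = onorm n.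
Proof.
move=> on; apply/eqP; rewrite eq_sym -subr_eq0 /onorm expr2 -rieszB -mulrBr.
by apply/eqP/(riesz_mul_eq0 on)/size_opoly_subXn.
Qed.

(** Orthogonality of P_(n+2) to X^j is inherited from P_n and P_(n+1) for j < n,
comes from the choice of the quotient for j = n, and from parity for j = n + 1.
*)
Lemma opoly_orth n j : (j < n)%N -> M (opoly n * 'X^j) = 0.
Proof.
suff [] : (forall j, (j < n)%N -> M (opoly n * 'X^j) = 0) /\
   (forall j, (j < n.+1)%N -> M (opoly n.+1 * 'X^j) = 0) by move=> /(_ j).
elim: n {j} => [|n [IH1 IH2]].
  split=> // -[] // _; rewrite opoly1 expr0 mulr1 -['X]expr1 rieszXn.
  exact: godd.
split=> // j jn.
rewrite opolyS mulrBl -scalerAl rieszB rieszZ mulrAC -exprS mulrC.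
move: jn; rewrite ltnS leq_eqVlt => /orP[/eqP ->|].
  rewrite opoly_parity; last by rewrite !addnS !addSn/= addnn odd_double.
  by rewrite opoly_parity ?mulr0 ?subr0// addnS/= addnn odd_double.
rewrite ltnS leq_eqVlt => /orP[/eqP ->|jn]; last first.
  by rewrite IH2 ?ltnS// IH1// mulr0 subr0.
rewrite (onormE IH2) (onormE IH1); have [h0|h0] := eqVneq (onorm n) 0.
  (* degenerate case: the quotient is 0, but so is ||P_(n+1)||^2 <= ||P_n||^2 *)
  rewrite h0 mulr0 subr0; apply/eqP; rewrite eq_le onorm_ge0 andbT -h0.
  by apply: onorm_leS => q; apply: riesz_mul_eq0.
by rewrite divfK// subrr.
Qed.

Lemma onorm_nincr n : onorm n.+1 <= onorm n.
Proof. by apply: onorm_leS => q; apply: riesz_mul_eq0; exact: opoly_orth. Qed.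

Lemma onorm0 : onorm 0 = 1.
Proof. by rewrite /onorm opoly0 expr1n -(expr0 'X) rieszXn. Qed.

Lemma onorm_eq0 n (q : {poly R}) : onorm n = 0 -> M (q * opoly n) = 0.
Proof.
move=> h0; have := riesz_cauchy_schwarz q (opoly n).
rewrite -/(onorm n) h0 mulr0 => /(conj (sqr_ge0 (M (q * opoly n)))) /andP.
by rewrite -eq_le eq_sym sqrf_eq0 => /eqP.
Qed.

(** [jcoef] lists the off-diagonal entries of multiplication by X in the
normalized basis P_n / ||P_n||, and [jvec j] the coordinates of X^j in it. *)
Definition jcoef n := Num.sqrt (onorm n.+1 / onorm n).
Definition jvec j n := M ('X^j * opoly n) / Num.sqrt (onorm n).

Lemma jcoef_ge0 n : 0 <= jcoef n. Proof. exact: sqrtr_ge0. Qed.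

Lemma jcoef_le1 n : jcoef n <= 1.
Proof.
rewrite -[leRHS]sqrtr1 ler_wsqrtr//.
have [->|h0] := eqVneq (onorm n) 0; first by rewrite invr0 mulr0 ler01.
by rewrite ler_pdivrMr ?mul1r ?onorm_nincr// lt_neqAle eq_sym h0 onorm_ge0.
Qed.

Lemma jvec0 n : jvec 0 n = (n == 0%N)%:R.
Proof.
rewrite /jvec expr0 mul1r; case: n => [|n].
  by rewrite opoly0 onorm0 sqrtr1 divr1 -(expr0 'X) rieszXn.
by rewrite -[opoly _]mulr1 -(expr0 'X) opoly_orth// mul0r.
Qed.

Lemma jvecn0 j : jvec j 0 = g j.
Proof. by rewrite /jvec opoly0 mulr1 onorm0 sqrtr1 divr1 rieszXn. Qed.

Lemma jcoef_jvec j n :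
  jcoef n * jvec j n.+1 = M ('X^j * opoly n.+1) / Num.sqrt (onorm n).
Proof.
have [h0|h0] := eqVneq (onorm n.+1) 0.
  by rewrite /jvec onorm_eq0// !mul0r mulr0.
have ? : Num.sqrt (onorm n.+1) != 0 by rewrite sqrtr_eq0 -ltNge lt_neqAle
  eq_sym h0 onorm_ge0.
rewrite /jcoef /jvec sqrtrM ?onorm_ge0// sqrtrV ?onorm_ge0//.
by rewrite mulrC -mulrA [X in _ * X]mulrA mulVf// mul1r.
Qed.

Lemma jvecS0 j : jvec j.+1 0 = jcoef 0 * jvec j 1.
Proof.
by rewrite jcoef_jvec /jvec opoly0 opoly1 mulr1 exprSr.
Qed.

(** Coordinates of X * X^j: this is X P_(n+1) = P_(n+2) + b P_n after
normalization. When P_(n+1) has norm 0, both sides are 0. *)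
Lemma jvecSS j n :
  jvec j.+1 n.+1 = jcoef n * jvec j n + jcoef n.+1 * jvec j n.+2.
Proof.
rewrite jcoef_jvec.
have [h0|h0] := eqVneq (onorm n.+1) 0.
  by rewrite /jvec /jcoef h0 sqrtr0 invr0 mul0r sqrtr0 !(mulr0, mul0r) addr0.
have hp : 0 < onorm n.+1 by rewrite lt_neqAle eq_sym h0 onorm_ge0.
have kp : 0 < onorm n := lt_le_trans hp (onorm_nincr n).
have ? : Num.sqrt (onorm n.+1) != 0 by rewrite gt_eqF// sqrtr_gt0.
have ? : Num.sqrt (onorm n) != 0 by rewrite gt_eqF// sqrtr_gt0.
rewrite opolyS mulrBr rieszB -scalerAr rieszZ.
rewrite /jvec /jcoef exprSr -mulrA sqrtrM ?onorm_ge0// sqrtrV ?onorm_ge0//.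
have hn := sqr_sqrtr (onorm_ge0 n); have hS := sqr_sqrtr (onorm_ge0 n.+1).
set r := Num.sqrt (onorm n) in hn *; set t := Num.sqrt (onorm n.+1) in hS *.
rewrite -hn -hS.
by field; apply/andP.
Qed.

End OrthogonalPolynomials.

(** * Powers of a Jacobi matrix *)

Section JacobiMoments.
Variables (R : realType) (g a : nat -> R) (c : nat -> nat -> R).
Hypothesis c0 : forall k, c 0 k = (k == 0%N)%:R.
Hypothesis cg : forall j, c j 0%N = g j.
Hypothesis cS0 : forall j, c j.+1 0%N = a 0%N * c j 1%N.
Hypothesis cSS : forall j k, c j.+1 k.+1 = a k * c j k + a k.+1 * c j k.+2.

Lemma jacobi_power_eq0 j k : (j < k)%N -> c j k = 0.
Proof.
elim: j k => [|j IH] [//|k] jk; first by rewrite c0.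
by rewrite cSS !IH ?mulr0 ?addr0//; move: jk; lia.
Qed.

(** With J the Jacobi matrix of entries a, [c j] is J^j e_0. The inner product
of J^i e_0 and J^j e_0 depends on i + j only, J being symmetric; so it equals
the one of J^(i+j) e_0 and e_0. *)
Lemma jacobi_moments i j K : (i + j < K)%N ->
  \sum_(k < K) c i k * c j k = g (i + j)%N.
Proof.
elim: j i => [|j IH] i ijK.
  case: K ijK => // K _; rewrite big_ord_recl big1 ?addr0 => [|k _].
    by rewrite c0 mulr1 addn0 cg.
  by rewrite c0 mulr0.
rewrite addnS -addSn -IH; last by rewrite addSn -addnS.
(* the right-hand side is symmetric in u and v: this is the symmetry of J *)
have H u v : (u + v < K)%N ->
    \sum_(k < K) c u.+1 k * c v k =
    \sum_(k < K) a k * (c u k * c v k.+1 + c u k.+1 * c v k).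
  move=> uvK; case: K uvK {IH ijK} => [//|K] uvK.
  rewrite big_ord_recl cS0 /=.
  under eq_bigr do rewrite /= cSS mulrDl.
  rewrite big_split /= addrCA addrC.
  rewrite -(big_ord_recl _ (fun k => a k * c u k.+1 * c v k)) /=.
  have -> : \sum_(k < K) a k * c u k * c v (bump 0 k) =
      \sum_(k < K.+1) a k * c u k * c v k.+1.
    rewrite [RHS]big_ord_recr /= (@jacobi_power_eq0 v K.+1) ?mulr0 ?addr0//.
    by apply: leq_ltn_trans uvK; exact: leq_addl.
  by rewrite -big_split; apply: eq_bigr => k _ /=; ring.
rewrite (H i j) ?(leq_trans _ ijK) ?addnS//.
under eq_bigr do rewrite mulrC.
rewrite (H j i) 1?addnC ?(leq_trans _ ijK) ?addnS//.
by apply: eq_bigr => k _; ring.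
Qed.
End JacobiMoments.

(** The operator form of the Stieltjes moment problem on [0,1]: a Jacobi matrix
J with ||J^j e_0||^2 = gam j. The square comes from symmetrizing gam, which
makes gam j the moment of order 2 j. *)
Lemma jacobi_of_stieltjes (R : realType) (gam : nat -> R) : gam 0%N = 1 ->
  (forall m (q : {poly R}), 0 <= riesz gam ('X^m * q ^+ 2)) ->
  (forall m (q : {poly R}),
     riesz gam ('X^(m.+1) * q ^+ 2) <= riesz gam ('X^m * q ^+ 2)) ->
  exists (a : nat -> R) (c : nat -> nat -> R),
  [/\ forall k, 0 <= a k <= 1,
      forall j, c j.+1 0%N = a 0%N * c j 1%N,
      forall j k, c j.+1 k.+1 = a k * c j k + a k.+1 * c j k.+2,
      forall j k, (j < k)%N -> c j k = 0 &
      forall j, \sum_(k < j.+1) c j k ^+ 2 = gam j].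
Proof.
move=> g0 gpos gcontr; pose g n := if odd n then 0 else gam n./2.
have gE (p : {poly R}) : riesz g p = riesz gam (even_poly p).
  by exact: riesz_even.
have gE2 (q : {poly R}) : riesz g (q ^+ 2) =
    riesz gam (even_poly q ^+ 2) + riesz gam ('X * odd_poly q ^+ 2).
  by rewrite gE even_poly_sqr rieszD.
have gp (q : {poly R}) : 0 <= riesz g (q ^+ 2).
  rewrite gE2 addr_ge0//; last exact: (gpos 1%N).
  by rewrite -[X in riesz _ X]mul1r -(expr0 'X) gpos.
have gc (q : {poly R}) : riesz g ('X^2 * q ^+ 2) <= riesz g (q ^+ 2).
  rewrite -exprMn mulrC gE2 gE2 even_polyMX odd_polyMX addrC exprMn lerD//.
    by have := gcontr 0%N (even_poly q); rewrite expr0 expr1 mul1r.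
  by have := gcontr 1%N (odd_poly q); rewrite mulrC.
have godd n : odd n -> g n = 0 by rewrite /g => ->.
have rec0 j : jvec g j.+1 0 = jcoef g 0 * jvec g j 1 by exact: jvecS0.
have recS j k : jvec g j.+1 k.+1 =
  jcoef g k * jvec g j k + jcoef g k.+1 * jvec g j k.+2.
  exact: jvecSS.
have c0 k : jvec g 0 k = (k == 0%N)%:R by exact: jvec0.
have cg j : jvec g j 0 = g j by exact: jvecn0.
exists (jcoef g), (jvec g).
have cz := jacobi_power_eq0 c0 recS.
split=> // [k|j].
  by rewrite jcoef_ge0 jcoef_le1.
have := jacobi_moments c0 cg rec0 recS (leqnn (j + j).+1).
rewrite addnn [X in _ = X -> _]/g odd_double doubleK => <-.
rewrite (big_ord_widen_cond j.*2.+1 xpredT (fun k => jvec g j k ^+ 2));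
  last first.
  by rewrite ltnS -addnn leq_addr.
rewrite big_mkcond; apply: eq_bigr => k _; rewrite -expr2.
by case: ltnP => // jk; rewrite cz ?expr0n.
Qed.

(** * Convex sequences and conditional positive definiteness *)

Import numFieldNormedType.Exports.

Section ConvexSequences.
Variable R : realType.
Implicit Types F gam : nat -> R.
Local Open Scope classical_set_scope.

(** The differences are nondecreasing with limit 0, hence nonpositive; the
sequence decreases to 0, hence is nonnegative. *)
Lemma convex_cvg0 F : (forall m, 0 <= F m.+2 - 2 * F m.+1 + F m) ->
  F n @[n --> \oo] --> 0 -> forall m, 0 <= F m /\ F m.+1 <= F m.
Proof.
move=> cF F0; pose d m := F m.+1 - F m.
have dnd : nondecreasing_seq d.
  by apply/nondecreasing_seqP => n; rewrite /d; have := cF n; lra.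
have d0 : d n @[n --> \oo] --> 0.
  rewrite -[X in _ --> X](subrr 0); apply: cvgB => //.
  by rewrite cvg_shiftS.
have Fni : nonincreasing_seq F.
  apply/nonincreasing_seqP => n; rewrite -subr_le0 -/(d n).
  have := nondecreasing_cvgn_le dnd (cvgP _ d0) n.
  by rewrite (cvg_lim _ d0).
move=> m; split; last by move/nonincreasing_seqP : Fni; exact.
have := nonincreasing_cvgn_ge Fni (cvgP _ F0) m.
by rewrite (cvg_lim _ F0).
Qed.

Lemma riesz_sqr gam (p : {poly R}) n : (size p <= n)%N ->
  riesz gam (p ^+ 2) = \sum_(i < n) \sum_(j < n) p`_i * p`_j * gam (i + j)%N.
Proof.
move=> pn.
have pE : p = \sum_(i < n) p`_i *: 'X^i.
  by rewrite -poly_def; apply/polyP => i; rewrite coef_poly;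
    case: ltnP => // ni; rewrite nth_default ?(leq_trans pn).
rewrite expr2 {1}pE mulr_suml linear_sum; apply: eq_bigr => i _.
rewrite -scalerAl linearZ /= riesz_mulXn (riesz_widen _ pn) mulr_sumr.
by apply: eq_bigr => j _; rewrite mulrA.
Qed.

(** A vector alpha with sum 0 is the coefficient vector of a polynomial that
vanishes at 1, that is, of a multiple of X - 1. The shifts by m record the
condition along the whole orbit of a vector. *)
Definition cpd_seq gam :=
  forall m (q : {poly R}), 0 <= riesz gam ('X^m * (q * ('X - 1)) ^+ 2).

(** (X - 1)^2 acts on m |-> L(X^m q^2) as the second difference. *)
Lemma cpd_seq_convex gam m (q : {poly R}) : cpd_seq gam ->
  0 <= riesz gam ('X^(m.+2) * q ^+ 2) - 2 * riesz gam ('X^(m.+1) * q ^+ 2) +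
       riesz gam ('X^m * q ^+ 2).
Proof.
move=> /(_ m q); rewrite -rieszZ -rieszB -rieszD; congr (0 <= riesz gam _).
by rewrite scaler_nat !exprS; ring.
Qed.

Lemma riesz_shift_cvg0 gam (p : {poly R}) : gam n @[n --> \oo] --> 0 ->
  riesz gam ('X^n * p) @[n --> \oo] --> 0.
Proof.
move=> g0; rewrite (_ : (fun _ => _) =
  fun n => \sum_(i < size p) p`_i * gam (n + i)%N); last first.
  by apply/funext => n; rewrite riesz_mulXn.
rewrite [X in _ --> X](_ : _ = \sum_(i < size p) p`_i * 0); last first.
  by rewrite big1// => i _; rewrite mulr0.
apply: cvg_big => [|i _]; first exact: add_continuous.
apply: cvgM; first exact: cvg_cst.
by rewrite cvg_shiftn.
Qed.

(** If the convex sequence gam increased at some n it would increase from then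
on, and the minimum of its first n + 1 values would be a lower bound. *)
Lemma cpd_seq_cvg0 gam : cpd_seq gam -> (forall n, 0 < gam n) ->
  ~ (exists2 e, 0 < e & forall n, e <= gam n) -> gam n @[n --> \oo] --> 0.
Proof.
move=> cg gp nex.
have cvx n : 0 <= gam n.+2 - 2 * gam n.+1 + gam n.
  by have := cpd_seq_convex n 1 cg; rewrite expr1n !mulr1 !rieszXn.
have ni n : gam n.+1 <= gam n.
  rewrite leNgt; apply/negP => gn; apply: nex.
  have [e e0 he] : exists2 e, 0 < e & forall i, (i <= n)%N -> e <= gam i.
    elim: n {gn} => [|n [e e0 he]].
      by exists (gam 0%N) => // i; rewrite leqn0 => /eqP ->.
    exists (Num.min e (gam n.+1)) => [|i]; first by rewrite lt_min e0 gp.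
    rewrite leq_eqVlt ltnS ge_min => /orP[/eqP->|/he ->//].
    by rewrite lexx orbT.
  have up k : gam (n + k)%N <= gam (n + k).+1 /\ gam n <= gam (n + k)%N.
    elim: k => [|k [IH1 IH2]]; first by rewrite addn0 (ltW gn).
    by rewrite addnS; have := cvx (n + k)%N; split; lra.
  exists e => // i; have [/he//|ni] := leqP i n.
  by rewrite -(subnKC (ltnW ni)) (le_trans (he n (leqnn n)))//;
    have [] := up (i - n)%N.
have nis : nonincreasing_seq gam by apply/nonincreasing_seqP.
apply/cvgrPdist_lt => e e0.
have [N gN] : exists N, gam N < e.
  apply: contrapT => h; apply: nex; exists e => // n; rewrite leNgt.
  by apply/negP => gn; apply: h; exists n.
exists N => //= n Nn; rewrite sub0r normrN gtr0_norm//.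
by apply: le_lt_trans gN; exact: nis.
Qed.

End ConvexSequences.

(** * Inner products and norms *)

Lemma ReD (R : realType) (z w : R[i]) :
  complex.Re (z + w) = complex.Re z + complex.Re w.
Proof. by case: z w => [? ?] [? ?]. Qed.

(** Lets an identity between complex inner products be checked on real parts
only, applied to x and to i x. *)
Lemma eq_complex_Re (R : realType) (z w : R[i]) : complex.Re z = complex.Re w ->
  complex.Re (Complex 0 1 * z) = complex.Re (Complex 0 1 * w) -> z = w.
Proof. by case: z w => [a b] [c d] /= ->;
  rewrite !mul0r !mul1r !sub0r => /oppr_inj ->. Qed.

Section HilbertFacts.
Variables (R : realType) (H : hilbert R).
Implicit Types x y z : H.

Lemma hdotC x y : hdot H x y = Num.conj (hdot H y x).
Proof. by rewrite hermC expr0 mul1r. Qed.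

Lemma hdotDl x y z : hdot H (x + y) z = hdot H x z + hdot H y z.
Proof. exact: linearDl. Qed.

Lemma hdotZl c x y : hdot H (c *: x) y = c * hdot H x y.
Proof. exact: linearZl_LR. Qed.

Lemma hdot0l y : hdot H 0 y = 0.
Proof. exact: linear0l. Qed.

Lemma hdotDr x y z : hdot H x (y + z) = hdot H x y + hdot H x z.
Proof. by rewrite hdotC hdotDl rmorphD /= -!hdotC. Qed.

Lemma hdotZr c x y : hdot H x (c *: y) = Num.conj c * hdot H x y.
Proof. by rewrite hdotC hdotZl rmorphM /= -!hdotC. Qed.

Lemma hdot_suml (n : nat) (c : nat -> R[i]) (v : nat -> H) y :
  hdot H (\sum_(k < n) c k *: v k) y = \sum_(k < n) c k * hdot H (v k) y.
Proof.
elim: n => [|n IH]; first by rewrite !big_ord0 hdot0l.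
by rewrite !big_ord_recr /= hdotDl hdotZl IH.
Qed.

Lemma hdot_sqr x : hdot H x x = ((hnorm x ^+ 2)%:C)%C.
Proof.
have := dnorm_ge0 (hdot H) x; rewrite /hnorm /dot_norm.
case: (hdot H x x) => a b; rewrite lecE /= => /andP[/eqP-> a0].
by rewrite sqr_sqrtr.
Qed.

Lemma hnorm_ge0 x : 0 <= hnorm x.
Proof. exact: sqrtr_ge0. Qed.

Lemma Re_hdotC x y : complex.Re (hdot H x y) = complex.Re (hdot H y x).
Proof. by rewrite hdotC; case: (hdot H y x). Qed.

Lemma hnorm_sqr x : hnorm x ^+ 2 = complex.Re (hdot H x x).
Proof. by rewrite hdot_sqr. Qed.

Lemma Re_hdot_abs x y : `|complex.Re (hdot H x y)| <= hnorm x * hnorm y.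
Proof.
rewrite -(@ler_pXn2r _ 2)// ?nnegrE ?mulr_ge0 ?hnorm_ge0//.
rewrite real_normK ?num_real// exprMn.
apply: quadratic_discriminant => t.
rewrite (_ : _ + _ = hnorm ((t%:C)%C *: x + y) ^+ 2) ?sqr_ge0//.
rewrite [RHS]hnorm_sqr hdotDl !hdotDr !hdotZl !hdotZr [hdot H y x]hdotC
  !hdot_sqr.
by case: (hdot H x y) => p q /=; ring.
Qed.

Lemma Re_hdot_le x y : complex.Re (hdot H x y) <= hnorm x * hnorm y.
Proof. exact: le_trans (ler_norm _) (Re_hdot_abs x y). Qed.

Lemma hnormZ c x : hnorm (c *: x) ^+ 2 = sqmod c * hnorm x ^+ 2.
Proof.
rewrite [LHS]hnorm_sqr hdotZl hdotZr hdot_sqr.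
by case: c => p q; rewrite /sqmod /=; ring.
Qed.
End HilbertFacts.

(** * Coordinates in the sequence space *)

Section Ell2Facts.
Variable R : realType.
Implicit Types x y : ell2 R.
Local Notation e_ := (Defs.basis R).

Lemma ell2_coordD x y n : (x + y) n = x n + y n.
Proof. by []. Qed.

Lemma ell2_coordZ c x n : (c *: x) n = c * x n.
Proof. by []. Qed.

Lemma ell2_coordN x n : (- x) n = - x n.
Proof. by []. Qed.

Lemma ell2_ext x y : (forall n, x n = y n) -> x = y.
Proof. by move=> xy; apply/val_inj/funext. Qed.

Lemma ell2_coord_sum (I : Type) (r : seq I) (F : I -> ell2 R) n :
  (\sum_(i <- r) F i) n = \sum_(i <- r) (F i n).
Proof. by elim/big_ind2: _ => // x1 x2 y1 y2 <- <-. Qed.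

Lemma basisE n k : e_ n k = (k == n)%:R.
Proof. by []. Qed.

Lemma hnorm_ell2_sqr x : hnorm x ^+ 2 = limn (series (fun n => sqmod (x n))).
Proof. by rewrite hnorm_sqr [hdot _ x x]ell2_dotxx. Qed.

Lemma ell2_partial_le x n : \sum_(0 <= k < n) sqmod (x k) <= hnorm x ^+ 2.
Proof. by rewrite hnorm_sqr; exact: sum_sqmod_le. Qed.

Lemma ell2_norm_le x (C : R) :
  (forall n, \sum_(0 <= k < n) sqmod (x k) <= C) -> hnorm x ^+ 2 <= C.
Proof. by move=> /series_sqmod_bounded[_]; rewrite -hnorm_ell2_sqr. Qed.

Definition ell2_trunc x n : ell2 R := \sum_(k < n) x k *: e_ k.

Lemma ell2_truncE x n k : ell2_trunc x n k = if (k < n)%N then x k else 0.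
Proof.
rewrite ell2_coord_sum.
have cE (i : 'I_n) : (x i *: e_ i : ell2 R) k = if k == i then x k else 0.
  by rewrite ell2_coordZ basisE; case: eqP => [->|_]; rewrite ?mulr1 ?mulr0.
under eq_bigr do rewrite cE.
case: ifPn => kn; last first.
  by rewrite big1// => i _; case: eqP => // ki; rewrite ki ltn_ord in kn.
rewrite (bigD1 (Ordinal kn))//= eqxx big1 ?addr0// => i;
  rewrite -val_eqE /= eq_sym.
by move=> /negbTE ->.
Qed.

Lemma ell2_tailE x n k : (x - ell2_trunc x n) k = if (k < n)%N then 0 else x k.
Proof. by rewrite ell2_coordD ell2_coordN ell2_truncE; case: ifP => _;
  rewrite ?subrr ?subr0. Qed.

Lemma limn_series_single (n : nat) (u : nat -> R) :
  (forall k, k != n -> u k = 0) -> limn (series u) = u n.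
Proof.
move=> u0; apply: lim_near_cst => //; exists n.+1 => // m /= nm.
rewrite /series /= (bigD1_seq n) ?mem_index_iota ?iota_uniq//= big1 ?addr0//.
Qed.

Lemma hdot_basisr x n : hdot (ell2 R) x (e_ n) = x n.
Proof.
rewrite -[LHS]/(ell2_dot x (e_ n)) /ell2_dot !(@limn_series_single n).
- by rewrite /ell2_mul basisE eqxx; case: (x n) => a b /=; congr Complex; ring.
- by move=> k kn; rewrite /ell2_mul basisE (negbTE kn) rmorph0 mulr0.
- by move=> k kn; rewrite /ell2_mul basisE (negbTE kn) rmorph0 mulr0.
Qed.

Lemma hdot_basisl x n : hdot (ell2 R) (e_ n) x = Num.conj (x n).
Proof. by rewrite hdotC hdot_basisr. Qed.

Lemma ell2_trunc_cvg x (e : R) : 0 < e ->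
  exists n, hnorm (x - ell2_trunc x n) < e.
Proof.
move=> e0; have e20 : 0 < (e / 2) ^+ 2 by rewrite exprn_gt0// divr_gt0.
have cx : cvgn (series (fun n => sqmod (x n))) := @ell2P _ x.
have /cvgrPdist_lt/(_ _ e20)[n _ /(_ n (leqnn n))] := cx.
rewrite -hnorm_ell2_sqr => xn; exists n.
have : hnorm (x - ell2_trunc x n) ^+ 2 <= (e / 2) ^+ 2.
  apply: ell2_norm_le => m; have [mn|nm] := leqP m n.
    rewrite big_nat big1 ?sqr_ge0// => k /andP[_ km].
    rewrite ell2_tailE (leq_trans km mn).
    by rewrite /sqmod /= expr0n addr0.
  rewrite (big_cat_nat (n := n)) ?(ltnW nm)// big_nat big1 => [|k /andP[_ kn]];
    last first.
    by rewrite ell2_tailE kn /sqmod /= expr0n addr0.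
  rewrite [leLHS]add0r.
  rewrite (eq_big_nat _ _ (F2 := fun k => sqmod (x k)))
      => [|k /andP[nk _]]; last first.
    by rewrite ell2_tailE ltnNge nk.
  rewrite ltW//; apply: le_lt_trans xn; rewrite ger0_norm; last first.
    by rewrite subr_ge0 ell2_partial_le.
  rewrite lerBrDl; apply: le_trans (ell2_partial_le x m).
  by rewrite /series /= -big_cat_nat ?(ltnW nm).
rewrite ler_sqr ?nnegrE ?hnorm_ge0 ?divr_ge0 ?(ltW e0)// => /le_lt_trans; apply.
by rewrite ltr_pdivrMr// ltr_pMr// ltr1n.
Qed.

(** Both sides are continuous in x and agree on finite combinations of the
basis. Adjointness and isometry are both reduced to basis vectors through this
lemma, which avoids rearranging series. *)
Lemma hdot_ext (K : hilbert R) (T : {linear ell2 R -> K}) (y : K) (z : ell2 R) :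
  bounded_op T -> (forall n, hdot K (T (e_ n)) y = hdot (ell2 R) (e_ n) z) ->
  forall x, hdot K (T x) y = hdot (ell2 R) x z.
Proof.
move=> [M TM] Te.
have tr x n : hdot K (T (ell2_trunc x n)) y = hdot (ell2 R) (ell2_trunc x n) z.
  rewrite /ell2_trunc linear_sum hdot_suml.
  under eq_bigr do rewrite linearZ.
  by rewrite (hdot_suml _ x (T \o e_)); apply: eq_bigr => k _; rewrite /comp Te.
have re x : complex.Re (hdot K (T x) y) = complex.Re (hdot (ell2 R) x z).
  apply/eqP; rewrite -subr_eq0 -normr_le0; apply/ler_addgt0Pl => e e0;
    rewrite addr0.
  (* C bounds the functional; the summand 1 makes it invertible *)
  pose C := `|M| * hnorm y + hnorm z + 1.
  have C0 : 0 < C.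
    by rewrite /C -addrA ltr_wpDl ?mulr_ge0 ?hnorm_ge0// ltr_wpDl ?hnorm_ge0.
  have [d [t [-> td xn]]] : exists d t : ell2 R, [/\ x = d + t,
      hdot K (T t) y = hdot (ell2 R) t z & hnorm d < e / C].
    have [n xn] := ell2_trunc_cvg x (divr_gt0 e0 C0).
    by exists (x - ell2_trunc x n), (ell2_trunc x n); rewrite subrK.
  rewrite linearD !hdotDl td !ReD opprD addrACA subrr addr0.
  apply: le_trans (ler_normB _ _) _.
  apply: le_trans (lerD (Re_hdot_abs _ _) (Re_hdot_abs _ _)) _.
  have Td : hnorm (T d) <= `|M| * hnorm d.
    by apply: le_trans (TM d) _; rewrite ler_wpM2r ?hnorm_ge0// ler_norm.
  rewrite ltr_pdivlMr// in xn; apply: le_trans (ltW xn).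
  have := ler_wpM2r (hnorm_ge0 y) Td; have := hnorm_ge0 d.
  by rewrite /C; nra.
move=> x; apply: eq_complex_Re => //.
by rewrite -(hdotZl _ (T x)) -(hdotZl _ x) -linearZ; exact: re.
Qed.

Lemma bounded_opD (H K : hilbert R) (S T : {linear H -> K}) :
  bounded_op S -> bounded_op T -> bounded_op (S \+ T).
Proof.
move=> [M SM] [N TN]; exists (M + N) => x /=.
apply: (@le_trans _ _ (hnorm (S x) + hnorm (T x))); last first.
  by rewrite mulrDl lerD.
rewrite -(@ler_pXn2r _ 2)// ?nnegrE ?addr_ge0 ?hnorm_ge0//.
rewrite hnorm_sqr hdotDl !hdotDr !ReD -!hnorm_sqr (Re_hdotC (T x)).
have := Re_hdot_le (S x) (T x); rewrite sqrrD; lra.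
Qed.

End Ell2Facts.

(** * Sums along partial injections *)

Section PartialInjections.
Variable R : realType.

Lemma ler_sum_subset (T : eqType) (F : T -> R) (s r : seq T) :
  (forall t, 0 <= F t) -> uniq s -> {subset s <= r} ->
  \sum_(t <- s) F t <= \sum_(t <- r) F t.
Proof.
move=> F0; elim: s r => [|a s IH] r /= => [_ _|/andP[as_ us] sr].
  by rewrite big_nil sumr_ge0.
have ar : a \in r by apply: sr; rewrite mem_head.
rewrite big_cons (perm_big _ (perm_to_rem ar)) big_cons lerD2l IH// => t ts.
have : t \in r by apply: sr; rewrite inE ts orbT.
by rewrite (perm_mem (perm_to_rem ar)) inE => /orP[/eqP ta|//];
  rewrite -ta ts in as_.
Qed.

Lemma ler_sum_uniq_nat (f : nat -> R) (C : R) (s : seq nat) :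
  (forall k, 0 <= f k) -> (forall n, \sum_(0 <= k < n) f k <= C) -> uniq s ->
  \sum_(k <- s) f k <= C.
Proof.
move=> f0 fC us; apply: le_trans (fC (\max_(k <- s) k).+1).
apply: ler_sum_subset => // k ks.
by rewrite mem_index_iota ltnS (@leq_bigmax_seq _ s xpredT id k).
Qed.

(** Reindexing a series of nonnegative terms along a partial injection does not
increase its sum; in this form, bounds on finite families are all that is needed
to see that an operator given by coordinates is bounded. *)
Lemma pinj_sum_le (T : eqType) (tau : nat -> option T) (F : T -> R) (C : R) n :
  (forall t, 0 <= F t) ->
  (forall i j t, tau i = Some t -> tau j = Some t -> i = j) ->
  (forall s, uniq s -> \sum_(t <- s) F t <= C) ->
  \sum_(0 <= k < n) oapp F 0 (tau k) <= C.
Proof.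
move=> F0 tinj FC.
have -> : \sum_(0 <= k < n) oapp F 0 (tau k) =
    \sum_(t <- pmap tau (index_iota 0 n)) F t.
  elim: (index_iota 0 n) => [|k l IH]; first by rewrite !big_nil.
  by rewrite big_cons IH /=; case: (tau k) => [t|] /=; rewrite ?big_cons ?add0r.
apply: FC; elim: (index_iota 0 n) (iota_uniq 0 (n - 0) : uniq (index_iota 0 n))
  => //= k l IH /andP[kl ul].
case tk : (tau k) => [t|] /=; last exact: IH.
rewrite IH// andbT mem_pmap; apply/mapP => -[j jl] tj.
by rewrite (tinj k j t tk (esym tj)) jl in kl.
Qed.

End PartialInjections.

(** * Operators given by their coordinates *)

Section Operators.
Variable R : realType.
Local Notation e_ := (Defs.basis R).

(** Packages a coordinate formula as a bounded operator. Only the existence is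
kept, so that later arguments see an abstract operator and its coordinates. *)
Lemma ell2_op_exists (H : hilbert R) (Phi : H -> nat -> R[i]) (M : R) :
  (forall c x y n, Phi (c *: x + y) n = c * Phi x n + Phi y n) ->
  (forall x n, \sum_(0 <= k < n) sqmod (Phi x k) <= M ^+ 2 * hnorm x ^+ 2) ->
  exists A : bop H (ell2 R), forall x n, A x n = Phi x n.
Proof.
move=> Plin PM.
have mem x : Phi x \in @ell2_pred R.
  by apply/ell2_predP; have /series_sqmod_bounded[] := PM x.
pose A x : ell2 R := Ell2 (mem x).
have Alin : linear A by move=> c x y; apply: ell2_ext => n; exact: Plin.
pose A' : {linear H -> ell2 R} :=
  HB.pack A (GRing.isLinear.Build _ _ _ _ A Alin).
have Ab : bounded_op A'.
  exists `|M| => x; rewrite -(@ler_pXn2r _ 2)// ?nnegrE ?mulr_ge0 ?hnorm_ge0//.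
  by rewrite exprMn real_normK ?num_real//; apply: ell2_norm_le; exact: PM.
by exists (Bop Ab).
Qed.

Lemma bop_add_exists (H K : hilbert R) (A B : bop H K) :
  exists C : bop H K, forall x, C x = A x + B x.
Proof. by exists (Bop (bounded_opD (bopP A) (bopP B))). Qed.

Lemma conj_real_complex (r : R) : Num.conj ((r%:C)%C : R[i]) = (r%:C)%C.
Proof. by rewrite -[LHS]/(Complex r (- 0)) oppr0. Qed.

Lemma conj_realM (r : R) (z : R[i]) :
  Num.conj ((r%:C)%C * z) = (r%:C)%C * Num.conj z.
Proof. by rewrite -[in RHS]conj_real_complex -rmorphM. Qed.

Section GridOperators.
Variables (T : countType).

(** The weighted composition x |-> w (x o f) on l^2(T), where l^2(T) is embedded
in l^2 by numbering the elements of T; coordinates that number no element of T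
are sent to 0. *)
Definition grid_op (f : T -> option T) (w : T -> R) (x : ell2 R) (n : nat)
  : R[i] :=
  if @pickle_inv T n is Some t then
    if f t is Some t' then ((w t)%:C)%C * x (pickle t') else 0
  else 0.

Lemma grid_op_pickle f w x t : grid_op f w x (pickle t) =
  if f t is Some t' then ((w t)%:C)%C * x (pickle t') else 0.
Proof. by rewrite /grid_op pickleK_inv. Qed.

Variables (f g : T -> option T) (w v : T -> R).
Hypothesis fgK : forall t t', f t = Some t' <-> g t' = Some t.
Hypothesis w1 : forall t, 0 <= w t <= 1.

Lemma grid_op_exists : exists A : bop (ell2 R) (ell2 R),
  forall x n, A x n = grid_op f w x n.
Proof.
apply: (@ell2_op_exists _ _ 1) => [c x y n|x n].
  rewrite /grid_op; case: pickle_inv => [t|]; last by rewrite mulr0 addr0.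
  case: (f t) => [t'|]; last by rewrite mulr0 addr0.
  by rewrite ell2_coordD ell2_coordZ mulrDr mulrCA.
rewrite expr1n mul1r.
pose tau n := omap pickle (obind f (@pickle_inv T n)).
apply: (@le_trans _ _
  (\sum_(0 <= k < n) oapp (fun m => sqmod (x m)) 0 (tau k))).
  apply: ler_sum => k _; rewrite /grid_op /tau.
  have s0 : sqmod (0 : R[i]) <= 0 by rewrite /sqmod /= expr0n addr0.
  case: pickle_inv => [t|] //=; case: (f t) => [t'|] //=.
  have /andP[w0 wl] := w1 t.
  rewrite sqmodM ler_piMl ?sqmod_ge0// /sqmod /= expr0n addr0.
  by rewrite expr_le1.
apply: pinj_sum_le => [m|i j m|s us]; first exact: sqmod_ge0.
  rewrite /tau; have := @pickle_invK T i; have := @pickle_invK T j.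
  case: (@pickle_inv T i) => [t|] //=;
    case: (@pickle_inv T j) => [u|] //= <- <-.
  case ft: (f t) => [t'|] //=;
    case fu: (f u) => [u'|] //= [<-] [/(pcan_inj pickleK_inv) u't'].
  move: ft fu => /fgK gt; rewrite u't' => /fgK; rewrite gt => -[->//].
apply: (@ler_sum_uniq_nat _ (fun m => sqmod (x m))) => // [k|N];
  first exact: sqmod_ge0.
exact: ell2_partial_le.
Qed.

Hypothesis wv : forall t t', f t = Some t' -> w t = v t'.

(** The inverse partial bijection, with the weights transported along f, gives
the adjoint: both operators pair e_n with the same basis vector. *)
Lemma grid_op_adjoint (A B : bop (ell2 R) (ell2 R)) :
  (forall x n, A x n = grid_op f w x n) ->
  (forall x n, B x n = grid_op g v x n) -> adjoint A B.
Proof.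
move=> AE BE x y; apply: hdot_ext (bopP A) _ x => n.
have Ae : A (e_ n) = if @pickle_inv T n is Some t' then
     if g t' is Some t then ((w t)%:C)%C *: e_ (pickle t) else 0
   else 0.
  apply: ell2_ext => m; rewrite AE /grid_op.
  have := @pickle_invK T m; have := @pickle_invK T n.
  case tm': (@pickle_inv T m) => [t|] /=;
    case un': (@pickle_inv T n) => [u|] /= un tm.
  - case gu: (g u) => [u'|].
      rewrite ell2_coordZ ?basisE -un -tm (inj_eq (pcan_inj pickleK_inv)).
      have [->|tu'] := eqVneq t u'.
        by move/fgK : gu => ->; rewrite ?basisE eqxx.
      rewrite mulr0; case ft: (f t) => [t'|//].
      rewrite ?basisE (inj_eq (pcan_inj pickleK_inv)).
      case: eqP => [e|]; last by rewrite mulr0.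
      by move: ft; rewrite e => /fgK; rewrite gu => -[] /esym/eqP;
        rewrite (negbTE tu').
    case ft: (f t) => [t'|//];
      rewrite ?basisE -un (inj_eq (pcan_inj pickleK_inv)).
    case: eqP => [e|]; last by rewrite mulr0.
    by move: ft; rewrite e => /fgK; rewrite gu.
  - case ft: (f t) => [t'|//]; rewrite ?basisE; case: eqP => [e|];
    last by rewrite mulr0.
    by rewrite -e pickleK_inv in un'.
  - case gu: (g u) => [u'|//]; rewrite ell2_coordZ ?basisE; case: eqP => [e|];
    last by rewrite mulr0.
    by rewrite e pickleK_inv in tm'.
  - by [].
rewrite Ae hdot_basisl BE /grid_op.
case: (@pickle_inv T n) => [u|]; last by rewrite hdot0l rmorph0.
case gu: (g u) => [u'|]; last by rewrite hdot0l rmorph0.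
by rewrite hdotZl hdot_basisl conj_realM -(wv (proj2 (fgK _ _) gu)).
Qed.

End GridOperators.

(** * The tensor product of a Jacobi matrix and the bilateral shift *)

Section JacobiShift.
Variable a : nat -> R.
Hypothesis a01 : forall k, 0 <= a k <= 1.
Local Notation pt k j := (@pickle (nat * int)%type (k, j)).

Let up (s : int) (t : nat * int) : option (nat * int) := Some (t.1.+1, t.2 + s).
Let down (s : int) (t : nat * int) : option (nat * int) :=
  if t.1 is k.+1 then Some (k, t.2 + s) else None.

(** The coordinates of J (x) U^(-s) on l^2(N) (x) l^2(Z), where J has the
entries a next to its diagonal; thus s = -1 moves the second index up by one. *)
Definition jacobi_shift_spec (s : int) (N : bop (ell2 R) (ell2 R)) : Prop :=
  (forall x k j, N x (pt k j) =
     (if k is k'.+1 then ((a k')%:C)%C * x (pt k' (j + s)) else 0) +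
     ((a k)%:C)%C * x (pt k.+1 (j + s))) /\
  (forall x n, @pickle_inv (nat * int)%type n = None -> N x n = 0).

(** J (x) U^(-s) is the sum of its parts below and above the diagonal, each of
which is a weighted partial bijection of the index set. *)
Lemma jacobi_shift_exists (s : int) : exists N S : bop (ell2 R) (ell2 R),
  [/\ adjoint N S, jacobi_shift_spec s N & jacobi_shift_spec (- s) S].
Proof.
have udK r t t' : up r t = Some t' <-> down (- r) t' = Some t.
  case: t t' => [k j] [[|k'] j']; rewrite /up /down /=; split => // -[<- <-].
    by rewrite addrK.
  by rewrite subrK.
have duK r t t' : down r t = Some t' <-> up (- r) t' = Some t.
  by rewrite udK opprK.
pose wu (t : nat * int) := a t.1; pose wd (t : nat * int) := a t.1.-1.
have wu1 t : 0 <= wu t <= 1 by exact: a01.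
have wd1 t : 0 <= wd t <= 1 by exact: a01.
have wud r t t' : up r t = Some t' -> wu t = wd t' by case: t => k j [<-].
have wdu r t t' : down r t = Some t' -> wd t = wu t'.
  by case: t => [[|k] j] //= [<-].
have [A AE] := grid_op_exists (duK s) wd1.
have [B BE] := grid_op_exists (udK s) wu1.
have [A' AE'] := grid_op_exists (udK (- s)) wu1.
have [B' BE'] := grid_op_exists (duK (- s)) wd1.
have AA' := grid_op_adjoint (duK s) (wdu s) AE AE'.
have BB' := grid_op_adjoint (udK s) (wud s) BE BE'.
have [N NE] := bop_add_exists A B; have [S SE] := bop_add_exists A' B'.
exists N, S; split=> [x y||].
- by rewrite NE SE hdotDl hdotDr AA' BB'.
- split=> [x k j|x n nN]; rewrite NE ell2_coordD AE BE.
    by rewrite !grid_op_pickle; case: k.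
  by rewrite /grid_op nN addr0.
- split=> [x k j|x n nN]; rewrite SE ell2_coordD AE' BE'.
    by rewrite !grid_op_pickle addrC; case: k.
  by rewrite /grid_op nN addr0.
Qed.

Lemma grid_ext (x y : ell2 R) : (forall k j, x (pt k j) = y (pt k j)) ->
  (forall n, @pickle_inv (nat * int)%type n = None -> x n = y n) -> x = y.
Proof.
move=> xy xy0; apply: ell2_ext => n.
have := @pickle_invK (nat * int)%type n;
  case E: (@pickle_inv _ n) => [[k j]|] /=.
  by move=> <-.
by move=> _; exact: xy0.
Qed.

(** Both products are J^2 (x) 1. *)
Lemma jacobi_shift_normal (N S : bop (ell2 R) (ell2 R)) (s : int) :
  jacobi_shift_spec s N -> jacobi_shift_spec (- s) S ->
  forall x, N (S x) = S (N x).
Proof.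
move=> [NE N0] [SE S0] x; apply: grid_ext => [k j|n nN];
  last by rewrite N0// S0.
rewrite NE SE; case: k => [|[|k]]; rewrite !(NE, SE) !addrK !subrK; ring.
Qed.

Section Embedding.
Variable v : nat -> nat -> R.
Hypothesis v0 : forall j k, (j < k)%N -> v j k = 0.
Hypothesis v1 : forall j, \sum_(k < j.+1) v j k ^+ 2 = 1.

Lemma sum_sqr_le1 j n : \sum_(0 <= k < n) v j k ^+ 2 <= 1.
Proof.
have [nj|jn] := leqP n j.+1.
  rewrite -(v1 j) -(big_mkord xpredT (fun k => v j k ^+ 2)) [leRHS](big_cat_nat
    (n := n))//=.
  by rewrite lerDl sumr_ge0// => k _; exact: sqr_ge0.
rewrite (big_cat_nat (n := j.+1)) ?(ltnW jn)//= big_mkord v1 big_nat big1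
  ?addr0// => k /andP[jk _].
by rewrite v0 ?expr0n.
Qed.

(** The map e_j |-> v_j (x) u_j with v_j the vector of coordinates [v j] and
u_j, for j >= 0, the basis of l^2(Z). It is isometric because the u_j are
orthogonal and the v_j are unit vectors. *)
Definition embed_seq (x : ell2 R) (n : nat) : R[i] :=
  if @pickle_inv (nat * int)%type n is Some (k, Posz j)
  then ((v j k)%:C)%C * x j
  else 0.

Lemma embed_exists : exists V : bop (ell2 R) (ell2 R),
  forall x n, V x n = embed_seq x n.
Proof.
apply: (@ell2_op_exists _ _ 1) => [c x y n|x n].
  rewrite /embed_seq; case: pickle_inv => [[k [j|j]]|]; rewrite ?mulr0 ?addr0//.
  by rewrite ell2_coordD ell2_coordZ mulrDr mulrCA.
rewrite expr1n mul1r.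
pose tau n := if @pickle_inv (nat * int)%type n is Some (k, Posz j)
  then Some (j, k) else None.
pose F (t : nat * nat) := v t.1 t.2 ^+ 2 * sqmod (x t.1).
have F0 t : 0 <= F t by rewrite mulr_ge0 ?sqr_ge0 ?sqmod_ge0.
rewrite (eq_bigr (fun m => oapp F 0 (tau m))) => [|m _]; last first.
  rewrite /embed_seq /tau; case: pickle_inv => [[k [j|j]]|] /=.
  - by rewrite sqmodM /F /sqmod /= expr0n addr0.
  - by rewrite /sqmod /= expr0n addr0.
  - by rewrite /sqmod /= expr0n addr0.
apply: pinj_sum_le => // [i j t|s us].
  have := @pickle_invK (nat * int)%type i;
    have := @pickle_invK (nat * int)%type j.
  rewrite /tau; case: (@pickle_inv _ i) => [[k [l|l]]|] //=.
  by case: (@pickle_inv _ j) => [[k' [l'|l']]|] //= <- <- [<-] [-> ->].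
pose B := (\max_(t <- s) maxn t.1 t.2).+1.
pose r := [seq (j, k) | j <- index_iota 0 B, k <- index_iota 0 B].
apply: (@le_trans _ _ (\sum_(t <- r) F t)).
  apply: ler_sum_subset => // -[j k] jks;
    rewrite /r allpairs_f ?mem_index_iota//=.
    by rewrite ltnS (leq_trans (leq_maxl j k))// (@leq_bigmax_seq _ s xpredT
      (fun t => maxn t.1 t.2) (j, k)).
  by rewrite ltnS (leq_trans (leq_maxr j k))// (@leq_bigmax_seq _ s xpredT (fun
    t => maxn t.1 t.2) (j, k)).
rewrite big_allpairs /=; apply: le_trans (ell2_partial_le x B).
apply: ler_sum => j _; rewrite /F /= -mulr_suml.
by rewrite ler_piMl ?sqmod_ge0// sum_sqr_le1.
Qed.

Lemma embed_isometry (V : bop (ell2 R) (ell2 R)) :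
  (forall x n, V x n = embed_seq x n) ->
  forall x y, hdot (ell2 R) (V x) (V y) = hdot (ell2 R) x y.
Proof.
move=> VE x y; apply: hdot_ext (bopP V) _ x => j.
have -> : V (e_ j) =
  \sum_(k < j.+1) ((v j k)%:C)%C *: e_ (pt (nat_of_ord k) (Posz j)).
  apply: ell2_ext => n; rewrite VE ell2_coord_sum /embed_seq.
  have := @pickle_invK (nat * int)%type n.
  have cE (k : 'I_j.+1) : (((v j k)%:C)%C *: e_ (pt (nat_of_ord k) (Posz j)) :
    ell2 R) n =
      ((v j k)%:C)%C * (n == pt (nat_of_ord k) (Posz j))%:R by [].
  rewrite (eq_bigr _ (fun k _ => cE k)) {cE}.
  case E: (@pickle_inv _ n) => [[k i]|] /=; last first.
    move=> _; rewrite big1// => k _; case: eqP => [e|]; last by rewrite mulr0.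
    by rewrite e pickleK_inv in E.
  move=> <-.
  under eq_bigr do rewrite (inj_eq (pcan_inj pickleK_inv)) xpair_eqE.
  case: i {E} => [i|i]; last first.
    by rewrite big1// => l _; rewrite andbF mulr0.
  have [->|ij] := eqVneq i j; last first.
    rewrite mulr0 big1// => l _;
      rewrite -[Posz i == Posz j]/(i == j) (negbTE ij) andbF mulr0//.
  under eq_bigr do rewrite eqxx andbT.
  rewrite mulr1.
  have [kj|jk] := ltnP k j.+1; last first.
    rewrite v0// big1// => l _; case: eqP => [e|_]; last by rewrite mulr0.
    by rewrite e leqNgt ltn_ord in jk.
  rewrite (bigD1 (Ordinal kj))//= eqxx mulr1 big1 ?addr0// => l.
  by rewrite -val_eqE /= eq_sym => /negbTE ->; rewrite mulr0.
rewrite (hdot_suml _ (fun k => ((v j k)%:C)%C) (fun k => e_ (pt k (Posz j)))).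
rewrite hdot_basisl.
under eq_bigr do rewrite hdot_basisl VE /embed_seq pickleK_inv conj_realM mulrA.
rewrite -mulr_suml -[RHS]mul1r; congr (_ * _).
under eq_bigr do rewrite -rmorphM -expr2.
by rewrite -rmorph_sum v1.
Qed.
End Embedding.
End JacobiShift.
End Operators.

(** * Subnormality from positivity of the moment functional *)

Section Subnormality.
Variable R : realType.

Lemma hatw_gt0 (lam : weights R) n : 0 < hatw lam n.
Proof. by apply: prodr_gt0 => i _; rewrite exprn_gt0// weight_gt0. Qed.

Lemma hatwS (lam : nat -> R) n : hatw lam n.+1 = hatw lam n * lam n ^+ 2.
Proof. by rewrite /hatw big_ord_recr. Qed.

Lemma hatw0 (lam : nat -> R) : hatw lam 0 = 1.
Proof. by rewrite /hatw big_ord0. Qed.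

Lemma sqrt_hatwS (lam : weights R) n :
  Num.sqrt (hatw lam n.+1) = Num.sqrt (hatw lam n) * lam n.
Proof.
by rewrite hatwS sqrtrM ?ltW ?hatw_gt0// sqrtr_sqr gtr0_norm ?weight_gt0.
Qed.

(** Let v_j be J^j e_0 divided by its norm. Then J v_j = lam j v_(j+1), which is
the intertwining relation with N = J (x) U for e_j |-> v_j (x) u_j. *)
Lemma subnormal_of_stieltjes (lam : weights R) :
  (forall m (q : {poly R}), 0 <= riesz (hatw lam) ('X^m * q ^+ 2)) ->
  (forall m (q : {poly R}),
     riesz (hatw lam) ('X^(m.+1) * q ^+ 2) <=
     riesz (hatw lam) ('X^m * q ^+ 2)) ->
  subnormal (wshift lam).
Proof.
move=> hpos hcontr.
have [a [c [a01 cS0 cSS cz csq]]] :=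
  jacobi_of_stieltjes (hatw0 lam) hpos hcontr.
pose r j := Num.sqrt (hatw lam j); pose v j k := c j k / r j.
have r0 j : r j != 0 by rewrite gt_eqF// sqrtr_gt0 hatw_gt0.
have rS j : r j.+1 = r j * lam j by exact: sqrt_hatwS.
have l0 j : lam j != 0 by rewrite gt_eqF// weight_gt0.
have v0 j k : (j < k)%N -> v j k = 0 by move=> jk; rewrite /v cz ?mul0r.
have v1 j : \sum_(k < j.+1) v j k ^+ 2 = 1.
  under eq_bigr do rewrite /v expr_div_n.
  rewrite -mulr_suml csq sqr_sqrtr ?ltW ?hatw_gt0// divff// gt_eqF//.
  exact: hatw_gt0.
have vS0 j : v j.+1 0%N * lam j = a 0%N * v j 1%N.
  by rewrite /v cS0 rS; field; rewrite r0 l0.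
have vSS j k : v j.+1 k.+1 * lam j = a k * v j k + a k.+1 * v j k.+2.
  by rewrite /v cSS rS; field; rewrite r0 l0.
have [N [S [NS Nspec Sspec]]] := jacobi_shift_exists a01 (-1).
have [V VE] := embed_exists v0 v1.
exists (ell2 R), N, V; split.
- by exists S => //; exact: jacobi_shift_normal Nspec Sspec.
- exact: embed_isometry VE.
have [NE N0] := Nspec.
move=> x; apply: grid_ext => [k j|n nN]; last by rewrite VE /embed_seq nN N0.
rewrite NE !VE /embed_seq !pickleK_inv.
(* the second index is 0, positive, or negative *)
case: j => [[|j]|j].
- have -> : wshift lam x 0%N = 0 by [].
  rewrite sub0r -[(- 1)%R]/(Negz 0) !mulr0 addr0.
  by case: k => [|k]; rewrite ?VE /embed_seq ?pickleK_inv ?mulr0.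
- rewrite intS addrAC subrr add0r -[wshift lam x j.+1]/(((lam j)%:C)%C * x j).
  rewrite mulrA -rmorphM; case: k => [|k].
    by rewrite add0r vS0 rmorphM mulrA.
  by rewrite VE /embed_seq !pickleK_inv vSS rmorphD !rmorphM mulrDl !mulrA.
- have -> : (Negz j + -1)%R = Negz j.+1 by rewrite !NegzE -opprD addrC -intS.
  by case: k => [|k]; rewrite ?VE /embed_seq ?pickleK_inv !mulr0 addr0.
Qed.
End Subnormality.

(** * Weighted shifts and their weights *)

Section ShiftFacts.
Variable R : realType.
Local Notation e_ := (Defs.basis R).
Implicit Types lam om : weights R.

Lemma hnorm_basis n : hnorm (e_ n) = 1.
Proof.
apply/eqP; rewrite -(@eqrXn2 _ 2) ?hnorm_ge0 ?ler01// expr1n hnorm_sqr.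
by rewrite hdot_basisr basisE eqxx.
Qed.

Lemma hnormZ_ge0 (H : hilbert R) (r : R) (x : H) : 0 <= r ->
  hnorm ((r%:C)%C *: x) = r * hnorm x.
Proof.
move=> r0; apply/eqP;
  rewrite -(@eqrXn2 _ 2) ?mulr_ge0 ?hnorm_ge0// hnormZ exprMn.
by rewrite /sqmod /= expr0n addr0.
Qed.

Lemma hnorm_wshift_basis lam n : hnorm (wshift lam (e_ n)) = lam n.
Proof. by rewrite wshift_basis hnormZ_ge0 ?hnorm_basis ?mulr1// ltW
  ?weight_gt0. Qed.

Lemma weight_le_opnorm lam n : lam n <= opnorm (wshift lam).
Proof.
rewrite -(hnorm_wshift_basis lam n); apply: ub_le_sup.
  have [M hM] := bopP (wshift lam); exists `|M| => _ [x /= x1 <-].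
  apply: le_trans (hM x) _; apply: (@le_trans _ _ (`|M| * hnorm x)).
    by rewrite ler_wpM2r ?hnorm_ge0// ler_norm.
  by rewrite ler_piMr.
by exists (e_ n) => //=; rewrite hnorm_basis.
Qed.

Lemma opnorm_le1 lam : (forall n, lam n <= 1) -> opnorm (wshift lam) <= 1.
Proof.
move=> l1; apply: ge_sup.
  by exists (hnorm (wshift lam 0)), 0 => //=;
    rewrite -[0](scale0r (e_ 0)) hnormZ_ge0 ?mul0r ?ler01.
move=> _ [x /= x1 <-]; apply: le_trans x1.
rewrite -(@ler_pXn2r _ 2)// ?nnegrE ?hnorm_ge0//; apply: ell2_norm_le => n.
apply: le_trans (sum_shift_seq_le x n l1) _.
by rewrite expr1n mul1r ell2_partial_le.
Qed.

Lemma hatw_le1 om n : opnorm (wshift om) <= 1 -> hatw om n <= 1.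
Proof.
move=> o1; elim: n => [|n IH]; first by rewrite hatw0.
have w0 := ltW (weight_gt0 om n).
by rewrite hatwS mulr_ile1 ?exprn_ge0 ?expr_le1 ?(ltW (hatw_gt0 _ _))//
  (le_trans (weight_le_opnorm om n)).
Qed.

Lemma iter_wshift lam n :
  iter n (wshift lam) (e_ 0) = ((Num.sqrt (hatw lam n))%:C)%C *: e_ n.
Proof.
elim: n => [|n IH]; first by rewrite hatw0 sqrtr1 scale1r.
set c := (X in X%:C%C) in IH *.
have wZ : wshift lam ((c%:C)%C *: e_ n) = (c%:C)%C *: wshift lam (e_ n).
  by exact: linearZ.
by rewrite iterS IH wZ wshift_basis scalerA -rmorphM sqrt_hatwS.
Qed.

Lemma hnorm_iter_wshift lam n :
  hnorm (iter n (wshift lam) (e_ 0)) ^+ 2 = hatw lam n.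
Proof.
by rewrite iter_wshift hnormZ_ge0 ?sqrtr_ge0// hnorm_basis mulr1 sqr_sqrtr ?ltW
  ?hatw_gt0.
Qed.

Lemma cpd_seq_hatw lam : cpd (wshift lam) -> cpd_seq (hatw lam).
Proof.
move=> hc m q; set p := q * _.
have [n pn] : exists n, (size p <= n.+1)%N by exists (size p).
rewrite riesz_mulXn (riesz_sqr _ pn).
have := hc (iter m (wshift lam) (e_ 0)) n (fun i => ((p`_i)%:C)%C).
have -> : \sum_(i < n.+1) ((p`_i)%:C)%C = 0 :> R[i].
  rewrite -rmorph_sum; have -> : \sum_(i < n.+1) p`_i = p.[1].
    by rewrite (horner_coef_wide _ pn); apply: eq_bigr => i _;
      rewrite expr1n mulr1.
  by rewrite /p hornerM !hornerE subrr mulr0.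
move=> /(_ erefl); congr is_true.
rewrite -(lecR _ _ : (0 <= ((_ : R)%:C)%C) = _) rmorph_sum; congr (0 <= _).
apply: eq_bigr => i _; rewrite rmorph_sum; apply: eq_bigr => j _.
rewrite -iterD hnorm_iter_wshift conj_real_complex -!rmorphM; congr (_%:C)%C.
by rewrite [(i + j + m)%N]addnC; ring.
Qed.

(** Otherwise hatw lam tends to 0, and for every q the convex sequence m |->
L(X^m q^2) tends to 0 too: this gives the Stieltjes conditions, hence
subnormality. *)
Lemma hatw_lower_bound lam : cpd (wshift lam) -> ~ subnormal (wshift lam) ->
  exists2 e : R, 0 < e & forall n, e <= hatw lam n.
Proof.
move=> hc; apply: contra_notP => nex.
have cg := cpd_seq_hatw hc; have g0 := cpd_seq_cvg0 cg (hatw_gt0 lam) nex.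
have H (q : {poly R}) :=
  convex_cvg0 (fun m => cpd_seq_convex m q cg) (riesz_shift_cvg0 (q ^+ 2) g0).
by apply: subnormal_of_stieltjes => m q; have [] := H q m.
Qed.

(** Its moment functional is evaluation at 1. *)
Lemma shift1_subnormal : subnormal (wshift (one_weights R)).
Proof.
have h1 : hatw (one_weights R) = fun=> 1.
  by apply/funext => n; rewrite /hatw big1// => i _; rewrite expr1n.
have hE m (q : {poly R}) : riesz (fun=> 1) ('X^m * q ^+ 2) = q.[1] ^+ 2.
  rewrite -(@riesz_ext _ _ (fun p : {poly R} => p.[1])) => [|c u v|n].
  - by rewrite hornerM hornerXn expr1n mul1r horner_exp.
  - by rewrite hornerD hornerZ.
  - by rewrite hornerXn expr1n.
by apply: subnormal_of_stieltjes => m q; rewrite h1 !hE// sqr_ge0.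
Qed.

(** The diagonal operator with entries sqrt(hatw om n / hatw lam n): its bound
is the hypothesis, its range contains every finite sequence. *)
Lemma quasi_affine_of_hatw_le lam om (e : R) : 0 < e ->
  (forall n, e * hatw om n <= hatw lam n) ->
  quasi_affine_transform (wshift lam) (wshift om).
Proof.
move=> e0 eh.
pose d n := Num.sqrt (hatw om n) / Num.sqrt (hatw lam n).
have so n : 0 < Num.sqrt (hatw om n) by rewrite sqrtr_gt0 hatw_gt0.
have sl n : 0 < Num.sqrt (hatw lam n) by rewrite sqrtr_gt0 hatw_gt0.
have d0 n : 0 < d n by rewrite divr_gt0.
have dn n : ((d n)%:C)%C != 0 :> R[i] by rewrite (inj_eq (@complexI _)) gt_eqF.
have dS n : d n.+1 * lam n = om n * d n.
  rewrite /d !sqrt_hatwS; field; rewrite !gt_eqF ?weight_gt0//; exact: sl.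
have dle n : d n ^+ 2 <= e^-1.
  rewrite /d expr_div_n !sqr_sqrtr ?(ltW (hatw_gt0 _ _))//.
  by rewrite ler_pdivrMr ?hatw_gt0// ler_pdivlMl.
have [X XE] : exists X : bop (ell2 R) (ell2 R),
    forall x n, X x n = ((d n)%:C)%C * x n.
  apply: (@ell2_op_exists _ _ _ (Num.sqrt e^-1)) => [c x y n|x n].
    by rewrite ell2_coordD ell2_coordZ mulrDr mulrCA.
  rewrite sqr_sqrtr ?invr_ge0 ?(ltW e0)//.
  apply: le_trans (ler_wpM2l _ (ell2_partial_le x n));
    last by rewrite invr_ge0 ltW.
  rewrite mulr_sumr; apply: ler_sum => k _;
    rewrite sqmodM ler_wpM2r ?sqmod_ge0//.
  by rewrite /sqmod /= expr0n addr0.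
have Xe k (c : R[i]) : X ((c * ((d k)^-1%:C)%C) *: e_ k) = c *: e_ k.
  apply: ell2_ext => n; rewrite XE !ell2_coordZ basisE.
  have [->|_] := eqVneq n k; last by rewrite !mulr0.
  by rewrite !mulr1 mulrCA -rmorphM divff ?rmorph1 ?mulr1// gt_eqF.
exists X; first split.
- move=> x y xy; apply: ell2_ext => n.
  by apply: (mulfI (dn n)); rewrite -!XE xy.
- move=> y r r0; have [n yn] := ell2_trunc_cvg y r0.
  exists (\sum_(k < n) (y k * ((d k)^-1%:C)%C) *: e_ k).
  rewrite linear_sum; under eq_bigr do rewrite Xe.
  exact: yn.
- move=> x; apply: ell2_ext => -[|n]; rewrite XE.
    by rewrite -[wshift lam x 0%N]/(0 : R[i]) mulr0.
  rewrite -[wshift lam x n.+1]/(((lam n)%:C)%C * x n).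
  rewrite -[wshift om (X x) n.+1]/(((om n)%:C)%C * X x n).
  by rewrite XE !mulrA -!rmorphM dS.
Qed.

Lemma quasi_affine_of_contraction lam om : cpd (wshift lam) ->
  ~ subnormal (wshift lam) -> opnorm (wshift om) <= 1 ->
  quasi_affine_transform (wshift lam) (wshift om).
Proof.
move=> hc /(hatw_lower_bound hc)[e e0 he] o1.
apply: (quasi_affine_of_hatw_le e0) => n; apply: le_trans (he n).
by rewrite ler_piMr ?hatw_le1// ltW.
Qed.

(** For a normal extension N with adjoint S, ||Nx||^2 = <x, S N x> and ||S N x||
= ||N N x||. *)
Lemma subnormal_norm_le (H : hilbert R) (T : bop H H) x : subnormal T ->
  hnorm (T x) ^+ 2 <= hnorm (T (T x)) * hnorm x.
Proof.
move=> [K [N [V [[S NS NSC] iso TV]]]].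
have Vn y : hnorm (V y) = hnorm y.
  by apply/eqP; rewrite -(@eqrXn2 _ 2) ?hnorm_ge0// !hnorm_sqr iso.
have Sn y : hnorm (S y) = hnorm (N y).
  apply/eqP; rewrite -(@eqrXn2 _ 2) ?hnorm_ge0// !hnorm_sqr -NS NSC.
  by rewrite Re_hdotC -NS.
rewrite -(Vn (T x)) -(Vn (T (T x))) -(Vn x) !TV mulrC -(Sn (N _))
  [leLHS]hnorm_sqr NS.
exact: Re_hdot_le.
Qed.

Lemma subnormal_weight_le om n : subnormal (wshift om) -> om n <= om n.+1.
Proof.
move=> /(subnormal_norm_le (e_ n));
  rewrite hnorm_wshift_basis hnorm_basis mulr1.
have w0 k := ltW (weight_gt0 om k).
have -> : wshift om (wshift om (e_ n)) = ((om n)%:C)%C *: wshift om (e_ n.+1).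
  by rewrite wshift_basis; exact: linearZ.
by rewrite hnormZ_ge0// hnorm_wshift_basis expr2 ler_pM2l ?weight_gt0.
Qed.

(** Logarithmic convexity at n = 2 reads (A + B)^2 <= A (A + 2 B), that is B^2
<= 0. *)
Lemma opnorm_affine_tail om (A B : R) : subnormal (wshift om) ->
  (forall n, hatw om n.+1 = A + B * n%:R) -> opnorm (wshift om) = 1.
Proof.
move=> som hE.
have wp k := weight_gt0 om k.
have lc : hatw om 2 ^+ 2 <= hatw om 1 * hatw om 3.
  rewrite (hatwS om 2) expr2 mulrCA ler_pM2l ?hatw_gt0// hatwS.
  rewrite ler_pM2l ?hatw_gt0// ler_sqr ?nnegrE ?(ltW (wp _))//.
  exact: subnormal_weight_le.
have B0 : B = 0.
  apply/eqP; rewrite -sqrf_eq0 eq_le sqr_ge0 andbT.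
  by move: lc; rewrite !hE; lra.
have w1 n : om n.+1 = 1.
  have := hatwS om n.+1; rewrite !hE B0 !mul0r addr0 => AE.
  have A0 : 0 < A by have := hatw_gt0 om 1; rewrite hE B0 mul0r addr0.
  have : om n.+1 ^+ 2 = 1.
    by apply: (mulfI (x := A)); rewrite ?gt_eqF// -AE mulr1.
  by move/eqP; rewrite sqrf_eq1 => /orP[/eqP//|/eqP e]; have := wp n.+1;
    rewrite e; lra.
apply/eqP; rewrite eq_le opnorm_le1 => [|[|n]] /=; last 2 first.
- by rewrite -(w1 0%N); exact: subnormal_weight_le.
- by rewrite w1.
by rewrite -(w1 0%N) weight_le_opnorm.
Qed.

End ShiftFacts.

(** * Shifts of type I and type II *)

Section Types.
Variable R : realType.
Implicit Types (om : weights R)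
  (nu : {finite_measure set (measurableTypeR R) -> \bar R}).
Local Open Scope classical_set_scope.

Lemma Qpol0 n : Qpol n.+1 (0 : R) = n%:R.
Proof.
case: n => [|n]; rewrite /Qpol /=; first by rewrite big_ord0.
rewrite big_ord_recl expr0 mulr1 big1 ?addr0 => [|i _];
  last by rewrite exprS mul0r mulr0.
by rewrite subn0 subn1.
Qed.

Lemma measurable_Qpol n : measurable_fun [set: measurableTypeR R] (@Qpol R n).
Proof.
apply: measurable_sum => i; apply: measurable_funM; first exact: measurable_cst.
exact: measurable_funX.
Qed.

Lemma Rintegral_Qpol nu n : nu.-negligible (~` [set 0]) ->
  \int[nu]_(x in `[0, +oo[) Qpol n x = Qpol n 0 * fine (nu `[0, +oo[).
Proof.
move=> nu0; rewrite -Rintegral_cst//; congr fine.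
apply: ae_eq_integral => //.
- apply/measurable_EFinP; apply: measurable_funTS; exact: measurable_Qpol.
- apply: negligibleS nu0 => x /= h x0; apply: h => _; by rewrite x0.
Qed.

(** Both types have a measure carried by {0}, where Q_n takes the value n - 1.
*)
Lemma opnorm_triplet om b nu : subnormal (wshift om) ->
  scalar_triplet om b 0 nu -> nu.-negligible (~` [set 0]) ->
  opnorm (wshift om) = 1.
Proof.
move=> som [_ _ _ _ hE] nu0; pose t := fine (nu `[0, +oo[).
apply: (@opnorm_affine_tail _ _ (1 + b) (b + t)) => // n.
rewrite hE Rintegral_Qpol// Qpol0 -/t mul0r addr0 -natr1; ring.
Qed.

(** Each point outside the support has a null rational interval around it, and
there are countably many of these. *)
Lemma supp0_negligible nu : supp nu = [set 0] -> nu.-negligible (~` [set 0]).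
Proof.
move=> snu.
pose J (q : rat * rat) : set (measurableTypeR R) := `]ratr q.1, ratr q.2[.
pose F k := if @unpickle (rat * rat)%type k is Some q then
  if nu (J q) == 0%E then J q else set0 else set0.
apply: (@negligibleS _ _ _ _ (\bigcup_k F k)); last first.
  apply: negligible_bigcup => k; rewrite /F.
  case: unpickle => [q|]; last exact: negligible_set0.
  case: eqP => [q0|_]; last exact: negligible_set0.
  by apply/negligibleP => //; exact: measurable_itv.
move=> x /= x0.
have : ~ supp nu x by rewrite snu.
rewrite /supp /= => /existsNP[U /not_implyP[oU /not_implyP[Ux /negP]]].
rewrite -leNgt => U0.
have /nbhs_ballP[r /= r0 rU] := open_nbhs_nbhs (conj oU Ux).
have [p] := @rat_in_itvoo R (x - r) x ltac:(by rewrite ltrBlDr ltrDl).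
rewrite in_itv /= => /andP[p1 p2].
have [q] := @rat_in_itvoo R x (x + r) ltac:(by rewrite ltrDl).
rewrite in_itv /= => /andP[q1 q2].
have [k kE] : exists k, @unpickle (rat * rat)%type k = Some (p, q).
  by exists (pickle (p, q)); exact: pickleK.
exists k; first exact: I; rewrite /F kE.
have Jx : J (p, q) x by rewrite /J /= in_itv /= p2 q1.
rewrite ifT//; rewrite -measure_le0; apply: le_trans U0.
apply: le_measure; rewrite ?inE.
- exact: measurable_itv.
- exact: open_measurable.
move=> y; rewrite /J /= in_itv /= => /andP[y1 y2]; apply: rU.
by rewrite /ball /= ltr_norml; apply/andP; split; lra.
Qed.

Lemma opnorm_type om : subnormal (wshift om) -> type_I om \/ type_II om ->
  opnorm (wshift om) = 1.
Proof.
move=> som [[_ [b [c [nu [tr nu0 c0]]]]]|[_ [b [c [nu [tr snu c0]]]]]].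
  rewrite c0 in tr; apply: (opnorm_triplet som tr).
  by apply/negligibleP; [exact: measurableC|exact/nu0/measurableC].
rewrite c0 in tr; apply: (opnorm_triplet som tr).
exact: supp0_negligible.
Qed.

End Types.

Theorem proposition2p3p2 (R : realType) :
  (forall lam : weights R, cpd (wshift lam) -> ~ subnormal (wshift lam) ->
     (forall om : weights R,
        subnormal (wshift om) -> opnorm (wshift om) <= 1 ->
        quasi_affine_transform (wshift lam) (wshift om)) /\
     [/\ subnormal (wshift (one_weights R)),
         opnorm (wshift (one_weights R)) <= 1 &
         quasi_affine_transform (wshift lam) (wshift (one_weights R))]) /\
  (forall om : weights R,
     subnormal (wshift om) -> type_I om \/ type_II om ->
     opnorm (wshift om) = 1).
Proof.
split=> [lam hc hs|om]; last exact: opnorm_type.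
have o1 : opnorm (wshift (one_weights R)) <= 1 by exact: opnorm_le1.
split=> [om _|]; first exact: quasi_affine_of_contraction.
by split=> //; [exact: shift1_subnormal|exact: quasi_affine_of_contraction].
Qed.
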